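(* Let $r\ge 3$ and let $U\le F_r$ be an $s_1/\ldots/s_r$ loop subgroup with respect to a basis $\{g_1,\ldots,g_r\}$ of $F_r$, having at most $r-2$ looplets (that is, at most $r-2$ indices $i$ satisfy $s_i=1$). Then $B(\operatorname{Stab}_{\operatorname{Aut}(F_r)}(U))$ is a congruence subgroup of level 2 of $\operatorname{GL}_r(\mathbb{Z})$, and its image in $\operatorname{GL}_r(\mathbb{Z}/2\mathbb{Z})$ under reduction modulo 2 is $S(v)$, where $v=(v_1,\ldots,v_r)\in(\mathbb{Z}/2\mathbb{Z})^r$ is given by \[ v_i=\begin{cases}0,&\text{if } s_i \text{ is odd},\\ 1,&\text{if } s_i\text{ is even}.\end{cases} \] Equivalently, $B(\operatorname{Stab}_{\operatorname{Aut}(F_r)}(U))=\{M\in\operatorname{GL}_r(\mathbb{Z})\mid v\cdot M\equiv v \pmod 2\}$.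
   Context: $F_r$ is the free group of rank $r$. A subgroup $U\le F_r$ is called an $s_1/\ldots/s_r$ loop subgroup (with integers $s_i\ge 1$) if there is a basis $\{g_1,\ldots,g_r\}$ of $F_r$ (fixed from now on) such that, for the action of $F_r$ on the left cosets of $U$ given by $w\cdot(vU)=wvU$: each $g_i$ acts as a permutation consisting of one cycle of length $s_i$ and no other non-trivial cycles; each such cycle includes the coset $U$; and apart from $U$ these cycles for different $i$ have no coset in common. The cycle of $g_i$ is called a loop of length $s_i$; a loop of length 1 is called a looplet. $\operatorname{Stab}_{\operatorname{Aut}(F_r)}(U)=\{\gamma\in\operatorname{Aut}(F_r)\mid\gamma(U)=U\}$. The map $B:\operatorname{Aut}(F_r)\to\operatorname{GL}_r(\mathbb{Z})$ is the homomorphism induced by abelianization, written with respect to the basis $g_1,\ldots,g_r$: $B(\gamma)=(\#_{g_i}\gamma(g_j))_{i,j=1,\ldots,r}$, where $\#_{g_i}:F_r\to\mathbb{Z}$ is the homomorphism with $g_i\mapsto 1$ and $g_j\mapsto 0$ for $j\ne i$. $\Gamma_2=\{A\in\operatorname{GL}_r(\mathbb{Z})\mid A\equiv \operatorname{Id}\pmod 2\}$. A subgroup of $\operatorname{GL}_r(\mathbb{Z})$ is said here to be a congruence subgroup of level 2 if it contains $\Gamma_2$. For a row vector $v\in(\mathbb{Z}/2\mathbb{Z})^r$, $S(v)=\{M\in\operatorname{GL}_r(\mathbb{Z}/2\mathbb{Z})\mid v\cdot M=v\}$. *)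

(* Defs.v *)
From HB Require Import structures.
From mathcomp Require Import all_boot all_order all_algebra.
From mathcomp Require Import boolp classical_sets.

Set Implicit Arguments.
Unset Strict Implicit.
Unset Printing Implicit Defensive.

Import GRing.Theory.

Local Open Scope classical_set_scope.
Local Open Scope ring_scope.

(* A group is free of rank r exactly when it has a basis indexed by 'I_r, a
   basis being a family with the universal property. *)
Definition free_basis (r : nat) (F : groupType) (g : 'I_r -> F) : Prop :=
  forall (H : groupType) (f : 'I_r -> H),
    (exists phi : {multiplicative F -> H}, forall i, phi (g i) = f i) /\
    (forall phi psi : {multiplicative F -> H},
       (forall i, phi (g i) = psi (g i)) -> phi =1 psi).

Definition translate (F : groupType) (w : F) (C : set F) : set F :=
  [set (w * x)%g | x in C].

Definition left_cosets (F : groupType) (U : set F) : set (set F) :=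
  [set translate v U | v in [set: F]].

(* On D, the map f is the cyclic permutation of c and the identity off c; c is
   a fixed point of f when its size is 1. *)
Definition single_cycle (T : eqType) (D : set T) (f : T -> T) (c : seq T)
    : Prop :=
  [/\ uniq c, fcycle f c, {in c, forall x, D x}
    & forall x, D x -> x \notin c -> f x = x].

Definition loop_subgroup (r : nat) (F : groupType) (g : 'I_r -> F)
    (s : 'I_r -> nat) (U : set F) : Prop :=
  [/\ group_closed (mem U),
      forall i, (1 <= s i)%N
    & exists c : 'I_r -> seq (set F),
        [/\ forall i, size (c i) = s i,
            forall i, single_cycle (left_cosets U) (translate (g i)) (c i),
            forall i, U \in c i
          & forall i j, i != j ->
              forall C, C \in c i -> C \in c j -> C = U]].

Definition exponent_hom (r : nat) (F : groupType) (g : 'I_r -> F) (i : 'I_r)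
    (h : F -> int) : Prop :=
  (forall x y, h (x * y)%g = h x + h y) /\ (forall j, h (g j) = (j == i)%:R).

(* The value 0 is only taken when there is no such homomorphism, which does not
   happen for a basis: see exponentP. *)
Definition exponent (r : nat) (F : groupType) (g : 'I_r -> F) (i : 'I_r)
    : F -> int :=
  xget (fun=> 0) [set h | exponent_hom g i h].

Definition aut_stab (F : groupType) (U : set F)
    : set {multiplicative F -> F} :=
  [set gamma | bijective gamma /\ gamma @` U = U].

Definition abel_mx (r : nat) (F : groupType) (g : 'I_r -> F)
    (gamma : {multiplicative F -> F}) : 'M[int]_r :=
  \matrix_(i, j) exponent g i (gamma (g j)).

Definition reduce2 (r : nat) (M : 'M[int]_r) : 'M['F_2]_r :=
  map_mx (fun z : int => z%:~R) M.

Definition Gamma2 (r : nat) : set 'M[int]_r :=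
  [set M | M \in unitmx /\ reduce2 M = 1%:M].

Definition GL_subgroup (R : comUnitRingType) (r : nat) (H : set 'M[R]_r)
    : Prop :=
  [/\ forall M, H M -> M \in unitmx,
      H 1%:M,
      forall M N, H M -> H N -> H (M *m N)
    & forall M, H M -> H (invmx M)].

Definition congruence_subgroup2 (r : nat) (H : set 'M[int]_r) : Prop :=
  GL_subgroup H /\ @Gamma2 r `<=` H.

Definition row_stab (r : nat) (v : 'rV['F_2]_r) : set 'M['F_2]_r :=
  [set M | M \in unitmx /\ v *m M = v].

Definition parity_row (r : nat) (s : 'I_r -> nat) : 'rV['F_2]_r :=
  \row_i (if odd (s i) then 0 else 1).

(* The additive group of the integers, in multiplicative notation. *)
Definition int_group : Type := int.
HB.instance Definition _ := Choice.on int_group.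
HB.instance Definition _ := isGroup.Build int_group
  (@addrA int) (@add0r int) (@addr0 int) (@addNr int) (@addrN int).

Lemma exponentP (r : nat) (F : groupType) (g : 'I_r -> F) (i : 'I_r) :
  free_basis g -> exponent_hom g i (exponent g i).
Proof.
move=> /(_ int_group (fun j => (j == i)%:R : int)) [[phi phiE] _].
apply: (@xgetPex _ (fun=> 0 : int) [set h | exponent_hom g i h]).
by exists (phi : F -> int); split=> [x y|j]; [exact: (gmulfM (s := phi) x y) | exact: phiE].
Qed.

Lemma exponent_unique (r : nat) (F : groupType) (g : 'I_r -> F) (i : 'I_r)
    (h : F -> int) :
  free_basis g -> exponent_hom g i h -> h =1 exponent g i.
Proof.
move=> gB [hM hg]; have [eM eg] := exponentP i gB.
have [_ uniq_hom] := gB int_group (fun j => (j == i)%:R : int).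
pose hP : isMultiplicative F int_group h :=
  isMultiplicative.Build F int_group h hM.
pose eP : isMultiplicative F int_group (exponent g i) :=
  isMultiplicative.Build F int_group (exponent g i) eM.
pose phi : {multiplicative F -> int_group} := HB.pack (h : F -> int_group) hP.
pose psi : {multiplicative F -> int_group} :=
  HB.pack (exponent g i : F -> int_group) eP.
by apply: (uniq_hom phi psi) => j; rewrite /= hg eg.
Qed.

(* Main.v *)
Require Import Defs.
From HB Require Import structures.
From mathcomp Require Import all_boot all_order all_algebra all_fingroup.
From mathcomp Require Import boolp classical_sets.
From mathcomp Require Import zify.

(** Let rho be the action of F on the cosets of U, written as a homomorphism
    to a permutation group acting on the right, with base point o the coset U
    itself: the image of g_i is a cycle of length s_i through o, and these
    loops meet only in o.

    A stabilizing automorphism gamma permutes the cosets, so rho composed with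
    gamma is conjugate to rho and the sign of rho (gamma w) is that of rho w.
    As a cycle of length s_i is odd exactly when s_i is even, the sign of
    rho w is the product of v with the exponent vector of w
    ([parity_exponent]); hence v *m B(gamma) = v modulo 2
    ([realized_row_stab]).

    Conversely, gamma stabilizes U as soon as rho composed with gamma is
    conjugate to rho by a permutation fixing o ([conj_aut_stab]).  This yields
    two families of matrices.  Inverting g_i reverses one loop, and reversing
    is a conjugation by the reflection of the loop that fixes o: all diagonal
    sign changes occur.  Multiplying g_j by a word w in the other generators
    with rho w = 1 does not change rho at all, and adds the exponent vector a
    of w to the column j: the matrix is the transvection 1 + a e_j.  Such a w
    exists for every a with a_j = 0 and v a even, provided that two of the
    generators other than g_j have loops of length at least 2: the commutator
    of two cycles meeting in one point is a three-cycle, its conjugates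
    generate the alternating group of the union of the loops of the g_k, k
    other than j ([bouquet_even]), so any word with exponents a and even image
    can be corrected to have trivial image by a word all of whose exponents
    vanish ([transvection_two_loops]).  If the condition on j fails, there is
    a looplet l; g_j can be multiplied by powers of g_l for free, and
    conjugating by a transvection 1 + b e_l, for which the condition holds,
    gives the rest ([transvection_stab]).

    It remains to see that these matrices generate the stabilizer of v modulo
    2.  A Euclidean algorithm with even quotients shows that they generate
    Gamma_2 ([Gamma2_generation]), and column reduction over F_2, in a basis
    in which v is a coordinate form, shows that their reductions generate S(v)
    ([row_stab_generation]); this step uses three different indices, as the
    exchange of two coordinates is out of reach when r = 2 and v = (1, 1). *)

Set Implicit Arguments.
Unset Strict Implicit.
Unset Printing Implicit Defensive.

Import GRing.Theory Num.Theory Order.TTheory.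

(** * Even permutations generated by three-cycles *)

Section ThreeCycles.
Variable T : finType.
Implicit Types (x y z : T) (s t : {perm T}).
Local Open Scope group_scope.

Definition cycle3 x y z : {perm T} := tperm x y * tperm x z.

Lemma cycle3V x y z : (cycle3 x y z)^-1 = cycle3 x z y.
Proof. by rewrite invMg !tpermV. Qed.

Lemma cycle3_rot x y z : x != z -> y != z -> cycle3 x y z = cycle3 y z x.
Proof.
move=> xz yz; rewrite /cycle3 conjgCV tpermV tpermJ tpermL tpermD //.
by rewrite [tperm x y]tpermC.
Qed.

Lemma cycle3J x y z s : cycle3 x y z ^ s = cycle3 (s x) (s y) (s z).
Proof. by rewrite conjMg !tpermJ. Qed.

Lemma cycle3_1 x y z : x != y -> y != z -> cycle3 x y z x = y.
Proof. by move=> xy yz; rewrite permM tpermL tpermD // eq_sym. Qed.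

Lemma cycle3_3 x y z : x != z -> y != z -> cycle3 x y z z = x.
Proof. by move=> xz yz; rewrite permM [tperm x y z]tpermD // tpermR. Qed.

Lemma cycle3_2 x y z : x != y -> y != z -> cycle3 x y z y = z.
Proof. by move=> xy yz; rewrite permM tpermR tpermL. Qed.

Lemma cycle3D x y z w : x != w -> y != w -> z != w -> cycle3 x y z w = w.
Proof. by move=> xw yw zw; rewrite permM [tperm x y w]tpermD // tpermD. Qed.

Lemma odd_cycle3 x y z : x != y -> x != z -> odd_perm (cycle3 x y z) = false.
Proof. by move=> xy xz; rewrite odd_permM !odd_tperm xy xz. Qed.

(** Only o, its image under s and its image under t are displaced: elsewhere
    at most one of s and t acts, so that it cancels in the commutator. *)
Lemma commg_cycle3 s t o : (forall x, s x != x -> t x != x -> x = o) ->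
  s o != o -> t o != o -> [~ s, t] = cycle3 o (t o) (s o).
Proof.
move=> st so to.
(* An image of o under one permutation is moved by it, hence not by the other. *)
have tso : t (s o) = s o.
  apply/eqP/negPn/negP => /(st (s o)); rewrite (inj_eq perm_inj) => /(_ so) E.
  by rewrite E eqxx in so.
have sto : s (t o) = t o.
  apply/eqP/negPn/negP => /(st (t o)); rewrite (inj_eq perm_inj) => /(_ to) E.
  by rewrite E eqxx in to.
have osto : t o != s o.
  by apply: contra_neq to => E; apply: (@perm_inj _ t); rewrite {1}E tso E.
apply: (mulgI (t * s)); rewrite -commgC; apply/permP => x.
rewrite permM [RHS]permM [(t * s) x]permM.
have [->|xo] := eqVneq x o; first by rewrite sto cycle3_2 // eq_sym.
have [txo|txo] := eqVneq (t x) o.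
  have -> : s x = x.
    by apply/eqP; apply: contraNT (xo) => sx; apply/eqP/st; rewrite // txo eq_sym.
  by rewrite txo cycle3_3 // eq_sym.
have [sxo|sxo] := eqVneq (s x) o.
  have -> : t x = x.
    by apply/eqP; apply: contraNT (xo) => tx; apply/eqP/st; rewrite // sxo eq_sym.
  by rewrite sxo cycle3_1 // eq_sym.
have [tx|tx] := eqVneq (t x) x.
  have E : t (s x) = s x.
    have [->//|sx] := eqVneq (s x) x.
    by apply/eqP/negPn/negP => /(st (s x)); rewrite (inj_eq perm_inj) => /(_ sx)/eqP; apply/negP.
  rewrite E tx cycle3D //; first by rewrite eq_sym.
    apply: contra_neq to; rewrite -{1}sto => /perm_inj E'.
    by apply: (@perm_inj _ t); rewrite E' tx.
  by rewrite (inj_eq perm_inj) eq_sym.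
have sx : s x = x by apply/eqP; apply: contraNT (xo) => sx; apply/eqP/st.
have E : s (t x) = t x.
  by apply/eqP/negPn/negP => /(st (t x)); rewrite (inj_eq perm_inj) => /(_ tx)/eqP; apply/negP.
rewrite E sx cycle3D //; first by rewrite eq_sym.
  by rewrite (inj_eq perm_inj) eq_sym.
apply: contra_neq so; rewrite -{1}tso => /perm_inj E'.
by apply: (@perm_inj _ s); rewrite E' sx.
Qed.

Section Subgroup.
Variable D : {perm T} -> Prop.
Hypotheses (D1 : D 1) (DM : forall s t, D s -> D t -> D (s * t))
           (DV : forall s, D s -> D s^-1).

(** Degenerate triples count as present, which makes the relation
    has_cycle3 _ _ b between points transitive without side conditions on its
    end points. *)
Definition has_cycle3 x y z :=
  x != y -> x != z -> y != z -> D (cycle3 x y z).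

Lemma has_cycle3_rot x y z : has_cycle3 x y z -> has_cycle3 y z x.
Proof.
move=> C yz yx zx; rewrite -cycle3_rot; [apply: C| |]; by rewrite // eq_sym.
Qed.

Lemma has_cycle3_flip x y z : has_cycle3 x y z -> has_cycle3 x z y.
Proof. by move=> C xz xy zy; rewrite -cycle3V; apply/DV/C => //; rewrite eq_sym. Qed.

Lemma has_cycle3_swap x y z : has_cycle3 x y z -> has_cycle3 y x z.
Proof. by move=> C; apply/has_cycle3_flip/has_cycle3_rot. Qed.

(** (x y b) conjugated by the inverse of (y z b) is (x b z). *)
Lemma has_cycle3_trans y x z b : y != b ->
  has_cycle3 x y b -> has_cycle3 y z b -> has_cycle3 x z b.
Proof.
move=> yb Cxy Cyz; have [->//|xy] := eqVneq x y.
have [->//|zy] := eqVneq z y.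
move=> xz xb zb; rewrite -cycle3V.
have -> : cycle3 x b z = cycle3 x y b ^ (cycle3 y z b)^-1.
  rewrite cycle3J cycle3V cycle3D ?cycle3_1 ?cycle3_2 //; by rewrite eq_sym.
have Dyz : D (cycle3 y z b) by apply: Cyz; rewrite // eq_sym.
by apply/DV; rewrite conjgE invgK; apply/DM/DM/DV => //; apply: Cxy.
Qed.

(** An even permutation moves a third point z besides a moved point x and its
    image y; composing it with the three-cycle (y x z) fixes x and moves no
    new point, so induction on the number of moved points applies. *)
Lemma even_perm_on_cycle3 (X : {set T}) :
  (forall x y z, x \in X -> y \in X -> z \in X -> has_cycle3 x y z) ->
  forall s, perm_on X s -> ~~ odd_perm s -> D s.
Proof.
move=> CX s; have [n] := ubnP #|[set x | s x != x]|.
elim: n s => // n IHn s /ltnSE-le_n Xs ev_s.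
have [->//|s1] := eqVneq s 1.
have [x sx] : exists x, s x != x.
  apply/existsP; apply: contraR s1; rewrite negb_exists => /forallP s1.
  by apply/eqP/permP => x; rewrite perm1; apply/eqP/negPn/s1.
set y := s x in sx; have ssx : s y != y by rewrite (inj_eq perm_inj).
have [z /and3P[zx zy sz]|none] := pickP [pred z | [&& z != x, z != y & s z != z]].
  have sX w : s w != w -> w \in X by move/(fintype.subsetP Xs).
  pose c := cycle3 y x z; have Dc : D c by apply: CX; rewrite ?sX // eq_sym.
  have fixc w : s w = w -> (s * c) w = w.
    move=> sw; have mv u : s u != u -> u != w by apply: contra_neq => ->.
    by rewrite permM sw cycle3D ?mv.
  have fixx : (s * c) x = x by rewrite permM cycle3_1 // eq_sym.
  have sub w : (s * c) w != w -> s w != w by apply: contra_neq => /fixc.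
  rewrite -(mulgK c s); apply/DM/DV => //; apply: IHn.
  - apply: leq_trans le_n; apply/proper_card/properP; split.
      by apply/fintype.subsetP => w; rewrite !inE => /sub.
    by exists x; rewrite !inE ?fixx ?eqxx.
  - by apply/fintype.subsetP => w; rewrite inE => /sub/sX.
  - by rewrite odd_permM odd_cycle3 ?addbF // eq_sym.
(* Without such a z, s is a transposition, which is odd. *)
have fix_s w : w != x -> w != y -> s w = w.
  by move=> wx wy; have:= none w; rewrite /= wx wy => /negbFE/eqP.
have sy : s y = x.
  apply/eqP/negPn/negP => yx.
  exact: (elimN eqP ssx (perm_inj (fix_s _ yx ssx))).
have sE : s = tperm x y.
  apply/permP => w; case: tpermP => [->|->|/eqP wx /eqP wy] //.
  exact: fix_s.
by move: ev_s; rewrite sE odd_tperm eq_sym sx.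
Qed.

End Subgroup.
End ThreeCycles.

(** * Bouquets of loops *)

Section Loops.
Variables (T : finType) (I : finType) (s : I -> {perm T}) (o : T).
Local Open Scope group_scope.

Definition bouquet : Prop :=
  (forall i x, x \notin porbit (s i) o -> s i x = x) /\
  (forall i k, i != k -> forall x,
     x \in porbit (s i) o -> x \in porbit (s k) o -> x = o).

Hypothesis sB : bouquet.

Lemma mem_porbit_step (t : {perm T}) x : (t x \in porbit t o) = (x \in porbit t o).
Proof. by rewrite -!eq_porbit_mem -(porbit_perm t 1 x) expg1. Qed.

Lemma bouquet_moved i x : s i x != x -> x \in porbit (s i) o.
Proof. by apply: contraR => /(proj1 sB) ->. Qed.

Lemma bouquet_fixed i k x : i != k -> x \in porbit (s i) o -> x != o -> s k x = x.
Proof.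
move=> ik xi xo; apply/eqP; apply: contraNT (xo) => /bouquet_moved xk.
by rewrite (proj2 sB i k ik x xi xk).
Qed.

Lemma porbit_fixed (t : {perm T}) x : t x = x -> porbit t x = [set x].
Proof.
move=> tx; apply/setP => y; rewrite inE.
apply/porbitP/eqP => [[m ->]|->]; last by exists 0; rewrite expg0 perm1.
by elim: m => [|m IH]; rewrite ?expg0 ?perm1 // expgSr permM IH.
Qed.

Lemma looplet_trivial i : #|porbit (s i) o| = 1%N -> s i = 1.
Proof.
move=> /eqP/cards1P[y E]; apply/permP => x; rewrite perm1.
have eqy z : (z \in porbit (s i) o) = (z == y) by rewrite E inE.
have [xi|] := boolP (x \in porbit (s i) o); last exact: (proj1 sB).
move: (xi); rewrite -mem_porbit_step eqy => /eqP ->.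
by move: xi; rewrite eqy => /eqP ->.
Qed.

(** The orbits of s i are its loop and one singleton for each other point. *)
Lemma odd_loop i : odd_perm (s i) = ~~ odd #|porbit (s i) o|.
Proof.
set c := porbit (s i) o; have oc : o \in c by exact: porbit_id.
have sc x : x \notin c -> porbit (s i) x = [set x].
  by move=> /(proj1 sB)/porbit_fixed.
have -> : odd_perm (s i) = odd #|T| (+) odd #|porbits (s i)| by [].
have -> : porbits (s i) = c |: [set [set x] | x in ~: c].
  apply/setP => A; rewrite in_setU1; apply/imsetP/orP => [[x _ ->]|[/eqP->|]].
  - have [xc|xc] := boolP (x \in c); first by left; rewrite eq_porbit_mem.
    by right; apply/imsetP; exists x; rewrite ?inE ?sc.
  - by exists o.
  - by case/imsetP => x; rewrite inE => xc ->; exists x; rewrite ?sc.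
rewrite cardsU1 (card_imset _ (@set1_inj T)) -(cardsC c).
have -> : c \notin [set [set x] | x in ~: c].
  apply/imsetP => -[x]; rewrite inE => xc E.
  by move: xc; rewrite E inE eqxx.
by rewrite !oddD /=; case: odd; case: odd.
Qed.

Section Flip.
Variable i : I.

(** The reflection of the loop i fixing o: it exchanges the images of o under
    opposite powers of s i.  The exponent m is determined by x up to powers
    fixing o, so that the choice does not matter. *)
Definition loop_flip_fun x : T :=
  if [pick m : 'I_#[s i] | (s i ^+ m) o == x] is Some m
  then (s i ^- m) o else x.

Lemma loop_flip_funX m : loop_flip_fun ((s i ^+ m) o) = (s i ^- m) o.
Proof.
have lt_m : (m %% #[s i] < #[s i])%N by rewrite ltn_mod order_gt0.
rewrite /loop_flip_fun; case: pickP => [n /eqP E|/(_ (Ordinal lt_m))]; last first.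
  by rewrite /= expg_mod_order eqxx.
apply: (@perm_inj _ (s i ^+ (m + n))); rewrite {2}expgnDr addnC expgnDr.
by rewrite !permM !permKV.
Qed.

Lemma loop_flip_funD x : x \notin porbit (s i) o -> loop_flip_fun x = x.
Proof.
move=> xi; rewrite /loop_flip_fun; case: pickP => // m /eqP E.
by case/porbitP: xi; exists m.
Qed.

Lemma loop_flip_funK : involutive loop_flip_fun.
Proof.
move=> x; have [/porbitP[m ->]|xi] := boolP (x \in porbit (s i) o).
  rewrite loop_flip_funX -expVgn invg_expg -expgnA loop_flip_funX.
  by rewrite expgnA -invg_expg expVgn invgK.
by rewrite !loop_flip_funD.
Qed.

Definition loop_flip : {perm T} := perm (inv_inj loop_flip_funK).

Lemma loop_flip_base : loop_flip o = o.
Proof.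
rewrite permE; have := loop_flip_funX 0.
by rewrite expg0 perm1 => ->; rewrite invg1 perm1.
Qed.

Lemma loop_flipJ : s i ^ loop_flip = (s i)^-1.
Proof.
apply/permP => x; rewrite -[x](permKV loop_flip) permJ.
set y := _ x; rewrite ![loop_flip _]permE; have [/porbitP[m ->]|yi] := boolP (y \in porbit (s i) o).
  rewrite -permM -expgSr !loop_flip_funX -[RHS]permM.
  by rewrite expgS invMg.
have sy := proj1 sB _ _ yi.
by rewrite sy loop_flip_funD //; apply: (@perm_inj _ (s i)); rewrite permKV.
Qed.

Lemma loop_flipJD k : k != i -> s k ^ loop_flip = s k.
Proof.
move=> ki; have fixk y : y \in porbit (s k) o -> loop_flip y = y.
  move=> yk; have [->|yo] := eqVneq y o; first exact: loop_flip_base.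
  rewrite permE loop_flip_funD //; apply: contra_neqN yo => yi.
  exact: (proj2 sB k i ki).
apply/permP => x; rewrite -[x](permKV loop_flip) permJ.
move: (_ x) => y; have [yk|yk] := boolP (y \in porbit (s k) o).
  by rewrite !fixk // mem_porbit_step.
rewrite (proj1 sB _ _ yk) (proj1 sB k) //; apply: contra yk => yk.
by rewrite -(perm_inj (fixk _ yk)).
Qed.
End Flip.

Section Alt.
Variables (J : {pred I}) (D : {perm T} -> Prop).
Hypotheses (D1 : D 1) (DM : forall s t, D s -> D t -> D (s * t))
  (DV : forall s, D s -> D s^-1)
  (DJ : forall k t, k \in J -> D t -> D (t ^ s k))
  (DR : forall i k, i \in J -> k \in J -> D [~ s i, s k]).

Let C := has_cycle3 D.

Lemma has_cycle3J k x y z : k \in J -> C x y z -> C (s k x) (s k y) (s k z).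
Proof.
move=> kJ Cxyz; rewrite /C /has_cycle3 !(inj_eq perm_inj) -cycle3J => xy xz yz.
exact/DJ/Cxyz.
Qed.

Lemma has_cycle3_pair i k : i \in J -> k \in J -> i != k ->
  C o (s i o) (s k o).
Proof.
move=> iJ kJ ik osi osk _; rewrite eq_sym in osi; rewrite eq_sym in osk.
rewrite -commg_cycle3 //; first exact: DR.
move=> x /bouquet_moved xk /bouquet_moved xi; exact: (proj2 sB _ _ ik).
Qed.

(** As s k fixes z, conjugation by its powers carries the three-cycle
    (o, s k o, z) along the loop k; consecutive points of the loop are then
    related by has_cycle3 _ _ z, and so are all points by transitivity. *)
Lemma has_cycle3_loop k z : k \in J -> s k z = z -> z != o -> C o (s k o) z ->
  forall x, x \in porbit (s k) o -> C x o z.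
Proof.
move=> kJ skz zo Cz x /porbitP[m ->].
have Cm n : C ((s k ^+ n) o) ((s k ^+ n.+1) o) z.
  elim: n => [|n IH]; first by rewrite expg0 perm1 expg1.
  by rewrite [s k ^+ n.+2]expgSr permM {1}expgSr permM -[z]skz; apply: has_cycle3J.
elim: m => [|m IH]; first by rewrite expg0 perm1 => /eqP.
have mz : (s k ^+ m) o != z.
  apply: contra_neq zo => E; apply: (@perm_inj _ (s k ^+ m)); rewrite E.
  by elim: (m) => [|n IHn]; rewrite ?expg0 ?perm1 // expgSr permM IHn.
apply: (has_cycle3_trans DM DV mz) => //.
exact/(has_cycle3_swap DV)/Cm.
Qed.

(** The loops k <- J are joined by three-cycles through the fixed point
    b = s k o.  On a loop other than k the permutation fixes b and
    [has_cycle3_loop] applies directly; the loop k itself is first related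
    through a = s i o, a point that s k does fix. *)
Lemma bouquet_even i k : i \in J -> k \in J -> i != k ->
  s i o != o -> s k o != o ->
  forall t, perm_on [set x | [exists j in J, x \in porbit (s j) o]] t ->
    ~~ odd_perm t -> D t.
Proof.
move=> iJ kJ ik sio sko; apply: (even_perm_on_cycle3 D1 DM DV).
set X := [set x | _].
set a := s i o in sio *; set b := s k o in sko *.
have ia : a \in porbit (s i) o by rewrite mem_porbit_step porbit_id.
have kb : b \in porbit (s k) o by rewrite mem_porbit_step porbit_id.
have rot := @has_cycle3_rot T D. have flip := @has_cycle3_flip T D DV.
have swap := @has_cycle3_swap T D DV. have trans := @has_cycle3_trans T D DM DV.
have Cb j x : j \in J -> j != k -> x \in porbit (s j) o -> C x o b.
  move=> jJ jk; apply: has_cycle3_loop => //.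
    by apply: (bouquet_fixed _ kb) => //; rewrite eq_sym.
  exact: has_cycle3_pair.
have Ca x : x \in porbit (s k) o -> C x o a.
  apply: has_cycle3_loop => //; first by apply: (bouquet_fixed _ ia).
  exact/flip/has_cycle3_pair.
have Ckb x : x \in porbit (s k) o -> C x o b.
  move=> xk; apply/flip/(trans a) => //; first exact/flip/Ca.
  exact/flip/Cb/ia.
have CX x : x \in X -> C x o b.
  rewrite inE => /existsP[j /andP[jJ xj]].
  by have [jk|jk] := eqVneq j k; [apply: Ckb; rewrite -jk | apply: Cb jk xj].
have CXb x y : x \in X -> y \in X -> C x y b.
  by move=> xX yX; apply: (trans o); [rewrite eq_sym | exact: CX | exact/swap/CX].
move=> x y z xX yX zX.
have [->|yb] := eqVneq y b; first exact/flip/CXb.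
apply/flip/(trans b); first by rewrite eq_sym.
  exact/flip/CXb.
exact/rot/rot/CXb.
Qed.
End Alt.
End Loops.

Local Open Scope classical_set_scope.
Local Open Scope ring_scope.

(** * Transvections and the level 2 congruence subgroup *)

Section Transvections.
Variables (R : comNzRingType) (r : nat).
Implicit Types (u : 'cV[R]_r) (w : 'rV[R]_r) (M X : 'M[R]_r).

Definition transvection u w : 'M[R]_r := 1%:M + u *m w.

Lemma transvection_mulr u w w' : w *m u = 0 ->
  transvection u w *m transvection u w' = transvection u (w + w').
Proof.
move=> wu; rewrite /transvection mulmxDr mulmx1 mulmxDl mul1mx.
by rewrite -mulmxA [w *m _]mulmxA wu mul0mx mulmx0 addr0 mulmxDr -addrA.
Qed.

Lemma transvection_mull u u' w : w *m u' = 0 ->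
  transvection u w *m transvection u' w = transvection (u + u') w.
Proof.
move=> wu; rewrite /transvection mulmxDr mulmx1 mulmxDl mul1mx.
by rewrite -mulmxA [w *m _]mulmxA wu mul0mx mulmx0 addr0 mulmxDl -addrA.
Qed.

Lemma transvectionJ X X' u w : X *m X' = 1%:M ->
  X *m transvection u w *m X' = transvection (X *m u) (w *m X').
Proof.
by move=> XX'; rewrite /transvection mulmxDr mulmx1 mulmxDl XX' !mulmxA.
Qed.

Lemma transvection0 w : transvection 0 w = 1%:M.
Proof. by rewrite /transvection mul0mx addr0. Qed.

Lemma transvectionN u w : w *m u = 0 ->
  transvection u w *m transvection (- u) w = 1%:M.
Proof.
by move=> wu; rewrite transvection_mull ?subrr ?transvection0 // mulmxN wu oppr0.
Qed.

Lemma mul_transvectionE M u w i l :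
  (M *m transvection u w) i l = M i l + (M *m u) i 0 * w 0 l.
Proof. by rewrite mulmxDr mulmx1 mulmxA mxE [(_ *m w) i l]mxE big_ord1. Qed.

Lemma mul_transvection_col u w (x : 'cV_r) :
  transvection u w *m x = x + (w *m x) 0 0 *: u.
Proof.
by rewrite mulmxDl mul1mx -mulmxA {1}[w *m x]mx11_scalar mul_mx_scalar.
Qed.

Lemma mul_row_transvection u w (y : 'rV_r) :
  y *m transvection u w = y + (y *m u) 0 0 *: w.
Proof.
by rewrite mulmxDr mulmx1 mulmxA {1}[y *m u]mx11_scalar mul_scalar_mx.
Qed.

Lemma mul_delta_row m (A : 'M[R]_(r, m)) j i :
  ((delta_mx 0 j : 'rV_r) *m A) 0 i = A j i.
Proof. by rewrite -rowE mxE. Qed.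

Lemma mul_delta_col m (A : 'M[R]_(m, r)) i k :
  (A *m (delta_mx k 0 : 'cV_r)) i 0 = A i k.
Proof. by rewrite -colE mxE. Qed.

Lemma mx11_eq0 (A : 'M[R]_1) : A 0 0 = 0 -> A = 0.
Proof. by rewrite {2}[A]mx11_scalar => ->; rewrite raddf0. Qed.

Lemma mul_delta_row0 u j : u j 0 = 0 -> (delta_mx 0 j : 'rV_r) *m u = 0.
Proof. by move=> uj; apply: mx11_eq0; rewrite mul_delta_row. Qed.

Lemma mul_delta_col0 w k : w 0 k = 0 -> w *m (delta_mx k 0 : 'cV_r) = 0.
Proof. by move=> wk; apply: mx11_eq0; rewrite mul_delta_col. Qed.

(** Splitting w into coordinates: the factors 1 + u e_j commute because each
    occurring e_j kills u. *)
Lemma transvection_closed (H : 'M[R]_r -> Prop) u w :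
  H 1%:M -> (forall M N, H M -> H N -> H (M *m N)) ->
  (forall j c, u j 0 = 0 -> H (transvection u (c *: delta_mx 0 j))) ->
  (forall j, w 0 j != 0 -> u j 0 = 0) -> H (transvection u w).
Proof.
move=> H1 HM Hu wu.
suff: H (transvection u w) /\ w *m u = 0 by case.
rewrite [w]row_sum_delta.
apply: (big_ind (fun w => H (transvection u w) /\ w *m u = 0)).
- by rewrite /transvection mulmx0 addr0 mul0mx.
- move=> w1 w2 [H1' wu1] [H2' wu2]; split; last by rewrite mulmxDl wu1 wu2 addr0.
  by rewrite -transvection_mulr //; apply: HM.
- move=> j _; have [->|/wu uj] := eqVneq (w 0 j) 0.
    by rewrite scale0r /transvection mulmx0 addr0 mul0mx.
  split; first exact: Hu.
  by rewrite -scalemxAl mul_delta_row0 ?scaler0.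
Qed.

End Transvections.

Section PartialReduction.
Variables (R : comUnitRingType) (r : nat).

(** Once the rows in S are unit vectors, the inverse matrix has the same rows,
    so the entries of another row i at the columns outside S are already
    coprime. *)
Lemma unit_row_remainder (M : 'M[R]_r) (S : {set 'I_r}) i :
  M \in unitmx -> (forall k, k \in S -> row k M = delta_mx 0 k) -> i \notin S ->
  \sum_(k | k \notin S) M i k * invmx M k i = 1.
Proof.
move=> uM MS iS; have /matrixP/(_ i i) := mulmxV uM.
rewrite !mxE eqxx (bigID (mem S)) /= big1 ?add0r // => k kS.
have: row k (M *m invmx M) = row k 1%:M by rewrite mulmxV.
rewrite row_mul MS // -rowE => /rowP/(_ i); rewrite !mxE => ->.
case: eqP => [ki|]; last by rewrite mulr0.
by rewrite -ki kS in iS.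
Qed.

Lemma unit_row_pivot (M : 'M[R]_r) (S : {set 'I_r}) i :
  M \in unitmx -> (forall k, k \in S -> row k M = delta_mx 0 k) -> i \notin S ->
  exists2 k, k \notin S & M i k != 0.
Proof.
move=> uM MS iS; have /eqP := unit_row_remainder uM MS iS.
have [k /andP[kS Mik] _|none] := pickP [pred k | (k \notin S) && (M i k != 0)].
  by exists k.
rewrite big1 => [|k kS]; first by rewrite eq_sym oner_eq0.
by have := none k; rewrite /= kS => /negbFE/eqP ->; rewrite mul0r.
Qed.

Lemma delta_row_off (M : 'M[R]_r) k j :
  row k M = delta_mx 0 k -> k != j -> M k j = 0.
Proof.
by move=> /rowP/(_ j); rewrite !mxE eqxx eq_sym /= => -> /negPf ->.
Qed.

End PartialReduction.

Lemma F2P (x : 'F_2) : x = 0 \/ x = 1.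
Proof. by case: x => [[|[|//]] i]; [left|right]; apply/val_inj. Qed.

Lemma addF2 (x : 'F_2) : x + x = 0.
Proof. by case: (F2P x) => ->; apply/val_inj. Qed.

Lemma addmxF2 m n (A : 'M['F_2]_(m, n)) : A + A = 0.
Proof. by apply/matrixP => i j; rewrite !mxE addF2. Qed.

Lemma oppmxF2 m n (A : 'M['F_2]_(m, n)) : - A = A.
Proof. by apply/eqP; rewrite -subr_eq0 -opprD addmxF2 oppr0. Qed.

(** Column reduction, one row at a time.  The set S collects the rows that are
    already unit vectors; starting from a nonempty S spares the operations
    adding a column of S to another one. *)
Lemma column_reduction_F2 r (H : 'M['F_2]_r -> Prop) (S : {set 'I_r}) :
  H 1%:M -> (forall M N, H M -> H N -> H (M *m N)) ->
  (forall k j, k \notin S -> j != k ->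
     H (transvection (delta_mx k 0) (delta_mx 0 j))) ->
  forall M, M \in unitmx -> (forall k, k \in S -> row k M = delta_mx 0 k) -> H M.
Proof.
move=> H1 HM HE M; have [n] := ubnP #|~: S|.
elim: n S M HE => // n IHn S M HE le_n uM MS.
have [/eqP S0|[i iS]] := set_0Vmem (~: S).
  have -> : M = 1%:M; last exact: H1.
  apply/row_matrixP => i; rewrite MS ?row1 //.
  by apply: contraTT S0 => iS; apply/set0Pn; exists i; rewrite inE.
rewrite inE in iS.
have invol k (w : 'rV['F_2]_r) : w 0 k = 0 ->
    transvection (delta_mx k 0) w *m transvection (delta_mx k 0) w = 1%:M.
  move=> wk; rewrite -{2}[delta_mx _ _]oppmxF2 transvectionN //.
  by apply/matrixP => a b; rewrite !ord1 mul_delta_col wk mxE.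
have MS0 k j : k \in S -> j \notin S -> M k j = 0.
  by move=> kS jS; apply: delta_row_off (MS k kS) (memPn jS k kS).
(* If the diagonal entry vanishes, adding a pivot column makes it 1. *)
wlog Mii : M uM MS MS0 / M i i = 1.
  move=> wl; case: (F2P (M i i)) => Mii; last exact: wl.
  have [k kS Mik] : exists2 k, k \notin S & M i k = 1.
    have [k kS Mik] := unit_row_pivot uM MS iS; exists k => //.
    by case: (F2P (M i k)) Mik => ->; rewrite ?eqxx.
  have ik : i != k by apply: contra_eq_neq Mii => ik; rewrite {2}ik Mik oner_eq0.
  pose E : 'M['F_2]_r := transvection (delta_mx k 0) (delta_mx 0 i).
  have EE : E *m E = 1%:M by apply: invol; rewrite mxE eqxx eq_sym (negPf ik).
  rewrite -[M]mulmx1 -EE mulmxA; apply: HM; last exact: HE.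
  have ME a b : (M *m E) a b = M a b + M a k * (b == i)%:R.
    by rewrite mul_transvectionE mul_delta_col mxE eqxx.
  have MSE a : a \in S -> row a (M *m E) = row a M.
    by move=> aS; apply/rowP => b; rewrite [LHS]mxE [RHS]mxE ME (MS0 a k) // mul0r addr0.
  apply: wl.
  - by rewrite unitmx_mul uM; have [->] := mulmx1_unit EE.
  - by move=> a aS; rewrite MSE // MS.
  - by move=> a b aS bS; rewrite ME !MS0 // mul0r addr0.
  - by rewrite ME Mii Mik eqxx mulr1 add0r.
(* The other entries of the row i are cleared by adding the column i. *)
pose w : 'rV['F_2]_r := \row_l (if l == i then 0 else M i l).
pose E : 'M['F_2]_r := transvection (delta_mx i 0) w.
have EE : E *m E = 1%:M by apply: invol; rewrite mxE eqxx.
rewrite -[M]mulmx1 -EE mulmxA; apply: (HM); last first.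
  apply: (transvection_closed H1 HM) => [j c|j].
    case: (F2P c) => -> ; first by rewrite scale0r /transvection mulmx0 addr0.
    rewrite scale1r mxE eqxx andbT; case: eqP => // /eqP ji _; exact: HE.
  by rewrite !mxE eqxx andbT; case: (j == i); rewrite ?eqxx.
have ME a b : (M *m E) a b = M a b + M a i * w 0 b.
  by rewrite mul_transvectionE mul_delta_col.
apply: (IHn (i |: S)).
- by move=> k j; rewrite in_setU1 negb_or => /andP[_ kS]; apply: HE.
- apply: leq_trans (ltnSE le_n); rewrite finset.setCU; apply: proper_card.
  by apply/properP; split; [exact: finset.subsetIr | exists i; rewrite !inE ?eqxx].
- by rewrite unitmx_mul uM; have [->] := mulmx1_unit EE.
- move=> k; rewrite in_setU1 => /predU1P[->|kS]; apply/rowP => b; rewrite mxE ME.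
    rewrite Mii mul1r !mxE eqxx; case: eqVneq => [->|_]; rewrite ?Mii ?addr0 //.
    exact: addF2.
  by rewrite (MS0 k i) // mul0r addr0 -(MS k kS) mxE.
Qed.

Section RowStabGenerators.
Variables (r : nat) (v : 'rV['F_2]_r) (H : 'M['F_2]_r -> Prop).
Hypotheses (r3 : (3 <= r)%N) (H1 : H 1%:M)
  (HM : forall M N, H M -> H N -> H (M *m N))
  (HT : forall (a : 'cV['F_2]_r) j, a j 0 = 0 -> v *m a = 0 ->
     H (transvection a (delta_mx 0 j))).

Let HTw (a : 'cV['F_2]_r) (w : 'rV['F_2]_r) : v *m a = 0 ->
  (forall j, w 0 j != 0 -> a j 0 = 0) -> H (transvection a w).
Proof.
move=> va wa; apply: (transvection_closed H1 HM) => // j c aj.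
case: (F2P c) => ->; last by rewrite scale1r; apply: HT.
by rewrite scale0r /transvection mulmx0 addr0.
Qed.

Section PivotColumn.
Variable p : 'I_r.
Hypothesis vp : v 0 p = 1.

(** The columns f k, k != p, form a basis of the kernel of v, and together with
    e_p a basis of the whole space in which v is the coordinate form of e_p. *)
Let f k : 'cV['F_2]_r := delta_mx k 0 + v 0 k *: delta_mx p 0.

Let fE k j : f k j 0 = (j == k)%:R + v 0 k * (j == p)%:R.
Proof. by rewrite !mxE !andbT. Qed.

Let wf (w : 'rV['F_2]_r) k : (w *m f k) 0 0 = w 0 k + v 0 k * w 0 p.
Proof. by rewrite mulmxDr -scalemxAr mxE mul_delta_col mxE mul_delta_col. Qed.

Let vf k : v *m f k = 0.
Proof. by apply: mx11_eq0; rewrite wf vp mulr1 addF2. Qed.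

Let third k : exists l, (l != k) && (l != p).
Proof.
have [l] : exists l, l \notin [set k; p]%SET.
  apply/existsP; rewrite -negb_forall; apply: contraTN r3 => /forallP A.
  rewrite -ltnNge ltnS -(card_ord r) (leq_trans _ (_ : #|[set k; p]%SET| <= 2)%N) //.
    by apply/subset_leq_card/fintype.subsetP => x _; apply: A.
  by rewrite cards2; case: eqP.
by rewrite !inE negb_or; exists l.
Qed.

(** If v_k = 0, the matrix splits into transvections 1 + e_k e_j.  Otherwise a
    conjugation brings another column to f k; with a third index l, the column
    to start from is e_l or e_k + e_l, according to the value of v_l. *)
Let fixing_transvection k : k != p -> H (transvection (f k) v).
Proof.
move=> kp; have [l /andP[lk lp]] := third k.
have fkl : f k l 0 = 0 by rewrite fE (negPf lk) (negPf lp) mulr0 addr0.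
have Hz i : v 0 i = 0 -> H (transvection (delta_mx i 0) v).
  move=> vi; apply: HTw => [|j]; first exact: mul_delta_col0.
  by rewrite mxE andbT; have [->|//] := eqVneq j i; rewrite vi eqxx.
case: (F2P (v 0 k)) => vk.
  by rewrite /f vk scale0r addr0; apply: Hz.
case: (F2P (v 0 l)) => vl.
  (* X maps e_l to e_l + f k and fixes v; the matrices 1 + a v with v a = 0
     multiply as their columns a add. *)
  pose X : 'M['F_2]_r := transvection (f k) (delta_mx 0 l).
  have HX : H X by exact: HT.
  have XX : X *m X = 1%:M.
    by rewrite {2}/X -[f k]oppmxF2 transvectionN ?mul_delta_row0.
  have vX : v *m X = v by rewrite mul_row_transvection vf mxE scale0r addr0.
  have Xl : X *m (delta_mx l 0 : 'cV_r) = delta_mx l 0 + f k.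
    by rewrite mul_transvection_col mul_delta_row mxE !eqxx scale1r.
  have := HM (HM (HM HX (Hz l vl)) HX) (Hz l vl).
  rewrite (transvectionJ _ _ XX) vX Xl transvection_mull ?mul_delta_col0 //.
  by rewrite addrAC addmxF2 add0r.
(* X maps e_k + e_l to f k and the form e_p to e_p + e_k; the rest w of v is
   supported where f k vanishes. *)
pose X : 'M['F_2]_r := transvection (f l) (delta_mx 0 k).
have flk : f l k 0 = 0 by rewrite fE eq_sym (negPf lk) (negPf kp) mulr0 addr0.
have HX : H X by exact: HT.
have XX : X *m X = 1%:M.
  by rewrite {2}/X -[f l]oppmxF2 transvectionN ?mul_delta_row0.
pose u : 'cV['F_2]_r := delta_mx k 0 + delta_mx l 0.
have HY : H (transvection u (delta_mx 0 p)).
  apply: HT; first by rewrite !mxE !andbT !(eq_sym p) (negPf kp) (negPf lp) addr0.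
  by apply: mx11_eq0; rewrite mulmxDr mxE !mul_delta_col vk vl addF2.
have Xu : X *m u = f k.
  rewrite mul_transvection_col mul_delta_row !mxE !eqxx (eq_sym k) (negPf lk).
  rewrite addr0 scale1r /u /f vk vl !scale1r addrACA addrA.
  by rewrite -[_ + _ + _ + _]addrA [X in _ + X]addrC addrACA addmxF2 addr0.
have pX : (delta_mx 0 p : 'rV_r) *m X = delta_mx 0 p + delta_mx 0 k.
  by rewrite mul_row_transvection mul_delta_row fE vl eqxx eq_sym (negPf lp) add0r mulr1 scale1r.
have := HM (HM HX HY) HX; rewrite (transvectionJ _ _ XX) Xu pX => HZ.
pose w : 'rV['F_2]_r := v - (delta_mx 0 p + delta_mx 0 k).
have Hw : H (transvection (f k) w).
  apply: HTw => // j; rewrite fE.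
  rewrite !mxE /=; have [->|jp] := eqVneq j p.
    by rewrite vp [p == k]eq_sym (negPf kp) addr0 subrr eqxx.
  have [->|jk] := eqVneq j k; last by rewrite mulr0 addr0.
  by rewrite vk add0r subrr eqxx.
have := HM HZ Hw; rewrite transvection_mulr ?addrNK.
  by rewrite /w addrC addrNK.
apply: mx11_eq0; rewrite wf !mxE vk mul1r !eqxx.
by rewrite [p == k]eq_sym (negPf kp) /= addr0 add0r addF2.
Qed.

(** P is the involution exchanging e_k and f k.  Conjugating by it turns the
    condition v *m M = v into a condition on the row p, which starts the column
    reduction. *)
Lemma row_stab_generation_pivot M : M \in unitmx -> v *m M = v -> H M.
Proof.
move=> uM vM; pose w : 'rV['F_2]_r := v - delta_mx 0 p.
pose P : 'M['F_2]_r := transvection (delta_mx p 0) w.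
have wp : w *m (delta_mx p 0 : 'cV_r) = 0.
  by apply: mul_delta_col0; rewrite !mxE vp !eqxx subrr.
have PP : P *m P = 1%:M.
  by rewrite {2}/P -[delta_mx p 0]oppmxF2 transvectionN.
have vP : v *m P = delta_mx 0 p.
  rewrite mul_row_transvection mul_delta_col vp scale1r /w addrA addmxF2 add0r.
  exact: oppmxF2.
have pP : (delta_mx 0 p : 'rV_r) *m P = v by rewrite -vP -mulmxA PP mulmx1.
have Pk k : k != p -> P *m (delta_mx k 0 : 'cV_r) = f k.
  move=> kp; rewrite mul_transvection_col mul_delta_col !mxE eqxx (negPf kp).
  by rewrite subr0.
have uP : P \in unitmx by have [] := mulmx1_unit PP.
have PK A : P *m (P *m A *m P) *m P = A.
  by rewrite !mulmxA PP mul1mx -mulmxA PP mulmx1.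
rewrite -[M]PK; pose N := P *m M *m P; rewrite -[P *m M *m P]/N.
apply: (@column_reduction_F2 r (fun N => H (P *m N *m P)) [set p]%SET _ _ _ N).
- by rewrite mulmx1 PP.
- move=> A B HA HB; have := HM HA HB.
  by rewrite -!mulmxA (mulmxA P P) PP mul1mx.
- move=> k j; rewrite inE => kp jk; rewrite (transvectionJ _ _ PP) Pk //.
  have [->|jp] := eqVneq j p; first by rewrite pP; apply: fixing_transvection.
  rewrite mul_row_transvection mul_delta_row mxE andbT (negPf jp) scale0r addr0.
  by apply: HT => //; rewrite fE (negPf jk) (negPf jp) mulr0 addr0.
- by rewrite !unitmx_mul uP uM.
- by move=> k; rewrite inE => /eqP ->; rewrite rowE !mulmxA pP vM vP.
Qed.

End PivotColumn.

Lemma row_stab_generation M : M \in unitmx -> v *m M = v -> H M.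
Proof.
move=> uM vM; have [v0|[p vp]] : v = 0 \/ exists p, v 0 p = 1.
- have [v0|/rV0Pn[p vp]] := eqVneq v 0; [by left | right; exists p].
  by case: (F2P (v 0 p)) vp => ->; rewrite ?eqxx.
- apply: (@column_reduction_F2 r H finset.set0) => // [k j _ jk|k].
  + by apply: HT; rewrite ?v0 ?mul0mx // mxE andbT (negPf jk).
  + by rewrite inE.
- exact: row_stab_generation_pivot vp _ uM vM.
Qed.

End RowStabGenerators.

Lemma even_shift_decreases (x y : int) : (0 < `|y| < `|x|)%N ->
  exists c : int, (absz (x + c * 2 * y)%R < `|x|)%N.
Proof.
move=> xy; case: (leP 0 (x * y)) => xy0; [exists (-1) | exists 1]; nia.
Qed.

Lemma abs_le1 (z : int) : (`|z| <= 1)%N -> z = 0 \/ z = 1 \/ z = - (1 : int).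
Proof. lia. Qed.

Definition sign_flip_mx (r : nat) (i : 'I_r) : 'M[int]_r :=
  transvection (- 2%:Z *: delta_mx i 0) (delta_mx 0 i).

Lemma sign_flip_mxE (r : nat) (i : 'I_r) (M : 'M[int]_r) a b :
  (M *m sign_flip_mx i) a b = if b == i then - M a b else M a b.
Proof.
rewrite mul_transvectionE -scalemxAr mxE mul_delta_col mxE eqxx /=.
case: eqP => [->|_]; last by rewrite mulr0 addr0.
by rewrite mulr1; lia.
Qed.

Lemma sign_flip_mxK (r : nat) (i : 'I_r) :
  sign_flip_mx i *m sign_flip_mx i = 1%:M.
Proof.
apply/matrixP => a b; rewrite -[sign_flip_mx i *m _]mul1mx mulmxA.
by rewrite !sign_flip_mxE; case: eqP => // _; rewrite opprK.
Qed.

Section Gamma2Generators.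
Variables (r : nat) (H : 'M[int]_r -> Prop).
Hypotheses (H1 : H 1%:M)
  (HM : forall M N, H M -> H N -> H (M *m N))
  (HE : forall k j c, k != j ->
     H (transvection ((c * 2) *: delta_mx k 0) (delta_mx 0 j)))
  (HS : forall i, H (sign_flip_mx i)).

(** A Euclidean algorithm on the rows with even quotients only.  If
    0 < |y| < |x|, one of x + 2y and x - 2y is smaller than x; when no such
    step applies to the row i, its nonzero entries outside S have the same
    absolute value, which bounds the entries in S as well.  By coprimality this
    value is 1, and parity forces the row to be a unit vector up to sign. *)
Lemma Gamma2_generation M : M \in unitmx -> reduce2 M = 1%:M -> H M.
Proof.
suff HGamma (S : {set 'I_r}) : M \in unitmx -> reduce2 M = 1%:M ->
    (forall k, k \in S -> row k M = delta_mx 0 k) -> H M.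
  by move=> uM M1; apply: (HGamma finset.set0) => // k; rewrite inE.
have [n] := ubnP #|~: S|; elim: n S M => // n IHn S M le_n.
have [/eqP S0 _ _ MS|[i]] := set_0Vmem (~: S)%SET.
  have -> : M = 1%:M; last exact: H1.
  apply/row_matrixP => i; rewrite MS ?row1 //.
  by apply: contraTT S0 => iS; apply/set0Pn; exists i; rewrite inE.
rewrite inE => iS.
have [m] := ubnP (\sum_l `|M i l|)%N; elim: m M => // m IHm M le_m uM M1 MS.
have MS0 k j : k \in S -> j \notin S -> M k j = 0.
  by move=> kS jS; apply: delta_row_off (MS k kS) (memPn jS k kS).
have [[k l] /and3P[kS kl lt_kl]|minM] :=
  pickP [pred kl : 'I_r * 'I_r | [&& kl.1 \notin S, kl.1 != kl.2
                                   & (0 < `|M i kl.1| < `|M i kl.2|)%N]].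
  rewrite /= in kS kl lt_kl.
  have [c lt_c] := even_shift_decreases lt_kl.
  pose E (c : int) : 'M[int]_r := transvection ((c * 2) *: delta_mx k 0) (delta_mx 0 l).
  have EE : E c *m E (- c) = 1%:M.
    rewrite /E mulNr scaleNr transvectionN // -scalemxAr mul_delta_col0 ?scaler0 //.
    by rewrite mxE (negPf kl).
  have ME a b : (M *m E c) a b = M a b + c * 2 * M a k * (b == l)%:R.
    by rewrite mul_transvectionE -scalemxAr mxE mul_delta_col mxE eqxx.
  rewrite -[M]mulmx1 -EE mulmxA; apply: (HM); last exact: HE.
  apply: IHm.
  - apply: leq_trans (ltnSE le_m); rewrite (bigD1 l) //= [ltnRHS](bigD1 l) //=.
    rewrite -addSn leq_add //.
      by rewrite ME eqxx mulr1 (leq_trans _ lt_c) // ltnS; lia.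
    by apply: leq_sum => j jl; rewrite ME (negPf jl) mulr0 addr0.
  - by rewrite unitmx_mul uM; have [->] := mulmx1_unit EE.
  - rewrite -M1; apply/matrixP => a b.
    by rewrite mxE ME [RHS]mxE !rmorphD /= !rmorphM /= (_ : 2%:~R = 0) ?mulr0 ?mul0r ?addr0 //; apply/val_inj.
  - move=> a aS; rewrite -MS //; apply/rowP => b; rewrite [LHS]mxE [RHS]mxE ME.
    by rewrite (MS0 a k) // mulr0 mul0r addr0.
have [k kS Mik] := unit_row_pivot uM MS iS.
have le_k l : (`|M i l| <= `|M i k|)%N.
  have [->//|kl] := eqVneq k l.
  by have := minM (k, l); rewrite /= kS kl absz_gt0 Mik /= => /negbT; rewrite -leqNgt.
have dvd_k l : l \notin S -> (M i k %| M i l)%Z.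
  move=> lS; have [->|Mil] := eqVneq (M i l) 0; first exact: dvdz0.
  have [->|kl] := eqVneq k l; first exact: dvdzz.
  have := minM (l, k); rewrite /= lS eq_sym kl absz_gt0 Mil /= => /negbT.
  rewrite -leqNgt => le_l; rewrite dvdzE.
  by have /eqP -> : `|M i k|%N == `|M i l|%N by rewrite eqn_leq le_l le_k.
have Mik1 : `|M i k|%N = 1%N.
  apply/eqP; rewrite -dvdn1.
  have: (M i k %| \sum_(l | l \notin S) M i l * invmx M l i)%Z.
    by apply: rpred_sum => l lS; exact/dvdz_mulr/dvd_k.
  by rewrite (unit_row_remainder uM MS iS) dvdzE.
have Mparity l : (M i l)%:~R = (i == l)%:R :> 'F_2.
  by have /matrixP/(_ i l) := M1; rewrite !mxE.
have Mi0 l : l != i -> M i l = 0.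
  rewrite eq_sym => il; have := Mparity l; rewrite (negPf il) => M0.
  have := @abs_le1 (M i l); rewrite -{1}Mik1 => /(_ (le_k l)).
  by case=> [//|[]] E; move: M0; rewrite E => /eqP.
have ik : k = i by apply: contra_neq_eq Mik; exact: Mi0.
have MSi a : a \in S -> M a i = 0 by move=> aS; apply: MS0.
wlog Mii : M uM M1 MS MSi Mi0 {le_m MS0 minM Mik le_k dvd_k Mik1 Mparity} / M i i = 1.
  move=> wl; have := @abs_le1 (M i i); rewrite -[X in `|M i X|%N]ik Mik1 => /(_ isT)[|[]] Mii.
  - by rewrite ik Mii in Mik.
  - exact: wl.
  pose E := sign_flip_mx i.
  have ME := sign_flip_mxE i M.
  have EE : E *m E = 1%:M by exact: sign_flip_mxK.
  rewrite -[M]mulmx1 -EE mulmxA; apply: (HM); last exact: HS.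
  apply: wl.
  - by rewrite unitmx_mul uM; have [->] := mulmx1_unit EE.
  - rewrite -M1; apply/matrixP => a b.
    rewrite mxE ME [RHS]mxE; case: eqP => // _; rewrite rmorphN /=.
    by case: (F2P (M a b)%:~R) => ->; apply/val_inj.
  - move=> a aS; rewrite -MS //; apply/rowP => b; rewrite [LHS]mxE [RHS]mxE ME.
    by case: eqP => // ->; rewrite MSi ?oppr0.
  - by move=> a aS; rewrite ME eqxx MSi ?oppr0.
  - by move=> l li; rewrite ME (negPf li) Mi0.
  - by rewrite ME eqxx Mii opprK.
apply: (IHn (i |: S)%SET) => //.
- apply: leq_trans (ltnSE le_n); rewrite finset.setCU; apply: proper_card.
  by apply/properP; split; [exact: finset.subsetIr | exists i; rewrite !inE ?eqxx].
- move=> k'; rewrite in_setU1 => /predU1P[->|]; last exact: MS.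
  apply/rowP => b; rewrite !mxE eqxx; have [->|bi] := eqVneq b i.
    by rewrite Mii.
  by rewrite Mi0.
Qed.

End Gamma2Generators.

Lemma reduce2M r (M N : 'M[int]_r) : reduce2 (M *m N) = reduce2 M *m reduce2 N.
Proof. exact: (map_mxM (intmul (1 : 'F_2))). Qed.

Lemma reduce2_1 r : reduce2 (1%:M : 'M[int]_r) = 1%:M.
Proof. exact: (map_mx1 (intmul (1 : 'F_2))). Qed.

Lemma reduce2_unit r (M : 'M[int]_r) : M \in unitmx -> reduce2 M \in unitmx.
Proof.
move=> uM; have: reduce2 M *m reduce2 (invmx M) = 1%:M.
  by rewrite -reduce2M mulmxV // reduce2_1.
by case/mulmx1_unit.
Qed.

Lemma reduce2_transvection r (a : 'cV[int]_r) j :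
  reduce2 (transvection a (delta_mx 0 j)) =
  transvection (map_mx (intmul 1) a) (delta_mx 0 j).
Proof.
apply/matrixP => k l; rewrite mxE -[transvection a _]mul1mx.
rewrite -[transvection (map_mx _ _) _]mul1mx !mul_transvectionE !mul1mx.
by rewrite !mxE rmorphD rmorphM /= !rmorph_nat.
Qed.

Section RowStabPreimage.
Variables (r : nat) (v : 'rV['F_2]_r) (H : 'M[int]_r -> Prop).
Hypotheses (r3 : (3 <= r)%N) (H1 : H 1%:M)
  (Hunit : forall M, H M -> M \in unitmx)
  (HM : forall M N, H M -> H N -> H (M *m N))
  (HT : forall (a : 'cV[int]_r) j, a j 0 = 0 -> v *m map_mx (intmul 1) a = 0 ->
     H (transvection a (delta_mx 0 j)))
  (HS : forall i, H (sign_flip_mx i)).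

Lemma row_stab_lift N : N \in unitmx -> v *m N = v ->
  exists2 M, H M & reduce2 M = N.
Proof.
apply: (row_stab_generation (H := fun N => exists2 M, H M & reduce2 M = N)) => //.
- by exists 1%:M; rewrite ?reduce2_1.
- by move=> _ _ [M HM' <-] [M' HM'' <-]; exists (M *m M'); [exact: HM | exact: reduce2M].
move=> a j aj va; pose b : 'cV[int]_r := map_mx (fun x : 'F_2 => (x : nat)%:Z) a.
have ba : map_mx (intmul 1) b = a by apply/matrixP => k l; rewrite !mxE -[RHS]natr_Zp.
exists (transvection b (delta_mx 0 j)); last by rewrite reduce2_transvection ba.
by apply: HT; rewrite ?ba // mxE aj.
Qed.

(** H contains some M' congruent to M modulo 2, and M'^-1 M lies in Gamma_2. *)
Lemma row_stab_preimage M : M \in unitmx -> v *m reduce2 M = v -> H M.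
Proof.
move=> uM vM; have [M' HM' M'M] := row_stab_lift (reduce2_unit uM) vM.
have uM' := Hunit HM'.
rewrite -[M](mulKVmx uM'); apply: HM => //.
apply: Gamma2_generation => //.
- move=> k j c kj; apply: HT; first by rewrite !mxE andbT eq_sym (negPf kj) mulr0.
  apply: mx11_eq0; rewrite mxE big1 // => l _.
  by rewrite !mxE !rmorphM /= (_ : 2%:~R = 0) ?mulr0 ?mul0r ?mulr0 //; apply/val_inj.
- by rewrite unitmx_mul unitmx_inv uM'.
- by rewrite reduce2M -M'M -reduce2M mulVmx // reduce2_1.
Qed.

End RowStabPreimage.

(** * Free groups, exponents and stabilizers *)

Section SubgroupType.
Variables (F : groupType) (P : F -> Prop).
Hypotheses (P1 : P 1%g) (PF : forall x y, P x -> P y -> P (x * y^-1)%g).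

Let p : {pred F} := fun x => `[< P x >].

Let p_closed : group_closed p.
Proof.
split; first exact/asboolP.
by move=> x y /asboolP Px /asboolP Py; apply/asboolP/PF.
Qed.

Record subgroup_type := SubgroupElt { subgroup_val :> F; _ : p subgroup_val }.
HB.instance Definition _ := [isSub for subgroup_val].
HB.instance Definition _ := [Choice of subgroup_type by <:].
HB.instance Definition _ := SubChoice_isSubGroup.Build F p subgroup_type p_closed.

(** The universal property gives a homomorphism to the subgroup P; composed with
    the inclusion it is an endomorphism of F fixing the basis, that is, the
    identity. *)
Lemma free_basis_gen (r : nat) (g : 'I_r -> F) :
  free_basis g -> (forall i, P (g i)) -> forall w, P w.
Proof.
move=> gB Pg.
have pg i : p (g i) by exact/asboolP.
have [[phi phiE] _] := gB subgroup_type (fun i => SubgroupElt (pg i)).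
pose f : F -> F := fun w => subgroup_val (phi w).
have fM : {morph f : x y / (x * y)%g} by move=> x y; rewrite /f !gmulfM.
pose fm : {multiplicative F -> F} :=
  HB.pack f (isMultiplicative.Build F F f fM).
have [_ uniq_hom] := gB F g.
pose idm : {multiplicative F -> F} :=
  HB.pack (id : F -> F) (isMultiplicative.Build F F id (fun x y => erefl)).
have fid : fm =1 idm by apply: uniq_hom => i; rewrite /= /f phiE.
move=> w; rewrite -[w]/(idm w) -fid; exact/asboolP/(valP (phi w)).
Qed.
End SubgroupType.

Section MulMorphism.
Variables (F H : groupType) (f : F -> H).
Hypothesis fM : {morph f : x y / (x * y)%g}.

Lemma mul_morph1 : f 1%g = 1%g.
Proof. by apply: (mulgI (f 1%g)); rewrite -fM !mulg1. Qed.

Lemma mul_morphV x : f x^-1%g = (f x)^-1%g.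
Proof. by apply: (mulgI (f x)); rewrite -fM !mulgV mul_morph1. Qed.
End MulMorphism.

Section FreeAut.
Variables (r : nat) (F : groupType) (g : 'I_r -> F).
Hypothesis gB : free_basis g.

Lemma free_basis_ind (P : F -> Prop) : P 1%g ->
  (forall x y, P x -> P y -> P (x * y)%g) -> (forall x, P x -> P x^-1%g) ->
  (forall i, P (g i)) -> forall w, P w.
Proof.
move=> P1 PM PV Pg; apply: (free_basis_gen P1 _ gB) => // x y Px Py.
exact/PM/PV.
Qed.

Lemma exponentM i x y : exponent g i (x * y)%g = exponent g i x + exponent g i y.
Proof. by have [-> _] := exponentP i gB. Qed.

Lemma exponent_basis i j : exponent g i (g j) = (j == i)%:R.
Proof. by have [_ ->] := exponentP i gB. Qed.

Lemma exponent1 i : exponent g i 1%g = 0.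
Proof. by apply: (addrI (exponent g i 1%g)); rewrite -exponentM mulg1 addr0. Qed.

Lemma exponentV i x : exponent g i x^-1%g = - exponent g i x.
Proof. by apply: (addrI (exponent g i x)); rewrite -exponentM mulgV exponent1 subrr. Qed.

Lemma exponent_comp (gamma : {multiplicative F -> F}) i w :
  exponent g i (gamma w) = \sum_k abel_mx g gamma i k * exponent g k w.
Proof.
elim/free_basis_ind: w => [|x y IHx IHy|x IH|j].
- by rewrite (mul_morph1 (gmulfM (s := gamma))) exponent1 big1 // => k _; rewrite exponent1 mulr0.
- rewrite gmulfM exponentM IHx IHy -big_split /=; apply: eq_bigr => k _.
  by rewrite exponentM mulrDr.
- rewrite (mul_morphV (gmulfM (s := gamma))) exponentV IH -sumrN; apply: eq_bigr => k _.
  by rewrite exponentV mulrN.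
- rewrite (bigD1 j) //= exponent_basis eqxx mulr1 big1 ?addr0 ?mxE // => k kj.
  by rewrite exponent_basis eq_sym (negPf kj) mulr0.
Qed.

Lemma abel_mx_comp (beta gamma delta : {multiplicative F -> F}) :
  beta =1 gamma \o delta ->
  abel_mx g beta = abel_mx g gamma *m abel_mx g delta.
Proof.
move=> E; apply/matrixP => i j; rewrite !mxE E /= exponent_comp.
by apply: eq_bigr => k _; rewrite [abel_mx g delta _ _]mxE.
Qed.

Lemma abel_mx_id (beta : {multiplicative F -> F}) :
  beta =1 id -> abel_mx g beta = 1%:M.
Proof. by move=> E; apply/matrixP => i j; rewrite !mxE E exponent_basis eq_sym. Qed.

Lemma basis_hom (H : groupType) (f : 'I_r -> H) :
  exists phi : {multiplicative F -> H}, forall i, phi (g i) = f i.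
Proof. by have [] := gB f. Qed.

Lemma hom_ext (H : groupType) (phi psi : {multiplicative F -> H}) :
  (forall i, phi (g i) = psi (g i)) -> phi =1 psi.
Proof. by have [_] := gB (fun i => phi (g i)); apply. Qed.

Variable U : set F.

Lemma aut_stab_comp (gamma delta : {multiplicative F -> F}) :
  aut_stab U gamma -> aut_stab U delta -> aut_stab U (gamma \o delta).
Proof.
move=> [bg gU] [bd dU]; split; first exact: bij_comp.
by rewrite -[RHS]gU -{2}dU -image_comp.
Qed.

Lemma aut_stab_inv (gamma : {multiplicative F -> F}) : aut_stab U gamma ->
  exists2 delta : {multiplicative F -> F}, aut_stab U delta
    & cancel gamma delta /\ cancel delta gamma.
Proof.
move=> [[f gK fK] gU].
pose delta : {multiplicative F -> F} :=
  HB.pack f (isMultiplicative.Build F F f (can2_gmulfM gK fK)).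
exists delta => //; split; first by exists gamma.
apply/seteqP; split=> [_ [x Ux <-]|x Ux] /=.
  by move: Ux; rewrite -{1}gU => -[y Uy <-]; rewrite /delta/= gK.
by exists (gamma x); [rewrite -gU; exists x | exact: gK].
Qed.

Definition realized : set 'M[int]_r := abel_mx g @` aut_stab U.

Lemma realizedM M N : realized M -> realized N -> realized (M *m N).
Proof.
move=> [gamma Ug <-] [delta Ud <-].
by exists (gamma \o delta); [exact: aut_stab_comp | exact: abel_mx_comp].
Qed.

Lemma realized1 : realized 1%:M.
Proof.
exists (idfun : {multiplicative F -> F}); last first.
  exact: (abel_mx_id (beta := idfun)).
split; first by exists id.
exact: image_id.
Qed.

Lemma realized_inv gamma : aut_stab U gamma ->
  exists2 delta, aut_stab U delta & abel_mx g gamma *m abel_mx g delta = 1%:M.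
Proof.
move=> Ug; have [delta Ud [_ dK]] := aut_stab_inv Ug; exists delta => //.
rewrite -(@abel_mx_comp (gamma \o delta)) //; exact: abel_mx_id.
Qed.

Lemma realized_unit M : realized M -> M \in unitmx.
Proof. by move=> [gamma Ug <-]; have [d _ /mulmx1_unit[]] := realized_inv Ug. Qed.

End FreeAut.

(** * The action on cosets *)

Lemma fcycle_iter (T : eqType) (f : T -> T) c x y :
  fcycle f c -> x \in c -> y \in c -> exists m, y = iter m f x.
Proof.
move=> fc xc; have [n c' E] := rot_to xc.
have: fcycle f (rot n c) by rewrite rot_cycle.
rewrite E /= rcons_path => /andP[/fpathP[m c'E] _].
rewrite -(mem_rot n) E c'E -[_ :: _]/(traject f x m.+1) => /trajectP[k _ ->].
by exists k.
Qed.

Section Translate.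
Variable F : groupType.
Implicit Types (a b : F) (C : set F).

Lemma translateM a b C : translate (a * b)%g C = translate a (translate b C).
Proof.
by rewrite /translate image_comp; congr image; apply/funext => x /=; rewrite mulgA.
Qed.

Lemma translate1 C : translate 1%g C = C.
Proof. by rewrite /translate; under eq_imagel do rewrite mul1g; rewrite image_id. Qed.

Lemma translateK a : cancel (translate a) (translate a^-1%g).
Proof. by move=> C; rewrite -translateM mulVg translate1. Qed.

Lemma translate_fix (U : set F) a : group_closed (mem U) ->
  translate a U = U <-> U a.
Proof.
move=> [/set_mem U1 UF]; have UD x y : U x -> U y -> U (x * y^-1)%g.
  by move=> /mem_set Ux /mem_set Uy; apply/set_mem/(UF x y Ux Uy).
have UV x : U x -> U x^-1%g by move=> Ux; rewrite -[x^-1%g]mul1g; apply: UD.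
have UM x y : U x -> U y -> U (x * y)%g.
  by move=> Ux Uy; rewrite -[y]invgK; apply/UD/UV.
split=> [<-|Ua]; first by exists 1%g; rewrite ?mulg1.
apply/seteqP; split=> [_ [x Ux <-]|x Ux]; first exact: UM.
exists (a^-1 * x)%g; last by rewrite mulKVg.
exact/UM/Ux/UV.
Qed.
End Translate.

Section LoopAction.
Variables (r : nat) (F : groupType) (g : 'I_r -> F) (s : 'I_r -> nat).
Variable U : set F.
Hypotheses (gB : free_basis g) (Ugrp : group_closed (mem U)).
Variable c : 'I_r -> seq (set F).
Hypotheses (c_size : forall i, size (c i) = s i)
  (c_cycle : forall i, single_cycle (left_cosets U) (translate (g i)) (c i))
  (Uc : forall i, U \in c i)
  (c_disj : forall i j, i != j -> forall C, C \in c i -> C \in c j -> C = U).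
Variable i0 : 'I_r.

Let L := flatten [seq c i | i <- enum 'I_r].

Let LP C : reflect (exists i, C \in c i) (C \in L).
Proof.
apply: (iffP flattenP) => [[_ /mapP[i _ ->] Ci]|[i Ci]]; first by exists i.
by exists (c i) => //; apply: map_f; rewrite mem_enum.
Qed.

Let c_coset i C : C \in c i -> left_cosets U C.
Proof. by have [_ _ + _] := c_cycle i; apply. Qed.

Let c_step i C : C \in c i -> translate (g i) C \in c i.
Proof. by have [_ fc _ _] := c_cycle i => Ci; rewrite (eqP (next_cycle fc Ci)) mem_next. Qed.

(** The union of the loops is stable under the generators, so it is the set of
    all cosets.  Stability under inverses holds because an injective map of a
    finite set to itself is surjective. *)
Let L_closed w C : C \in L -> translate w C \in L.
Proof.
move: C; elim/(free_basis_ind gB): w => [|x y IHx IHy|x IH|i] C CL.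
- by rewrite translate1.
- by rewrite translateM; apply/IHx/IHy.
- pose f (D : seq_sub L) : seq_sub L := SeqSub (IH _ (ssvalP D)).
  have f_inj : injective f.
    by move=> D E /(congr1 val)/(can_inj (translateK x))/val_inj.
  have /(congr1 val)/= <- := f_invF f_inj (SeqSub CL).
  by rewrite translateK ssvalP.
- have [Ci|Ci] := boolP (C \in c i); first by apply/LP; exists i; apply: c_step.
  have [_ _ _ fix_off] := c_cycle i; rewrite fix_off //.
  by have /LP[k Ck] := CL; apply: c_coset Ck.
Qed.

Definition coset_type : finType := seq_sub L.

(** The inverse turns the left action on cosets into a right action, since
    products of permutations are read from left to right. *)
Definition coset_act w (C : coset_type) : coset_type :=
  SeqSub (L_closed w^-1%g (ssvalP C)).

Lemma coset_act_inj w : injective (coset_act w).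
Proof. by move=> D E /(congr1 val)/(can_inj (translateK _))/val_inj. Qed.

Definition coset_perm w : {perm coset_type} := perm (@coset_act_inj w).

Lemma val_coset_perm w C : val (coset_perm w C) = translate w^-1%g (val C).
Proof. by rewrite permE. Qed.

Lemma coset_permM : {morph coset_perm : x y / (x * y)%g}.
Proof.
move=> x y; apply/permP => C; apply: val_inj.
by rewrite permM !val_coset_perm invgM translateM.
Qed.

Definition base_coset : coset_type := SeqSub (introT (LP U) (ex_intro _ i0 (Uc i0))).

Lemma coset_perm_base w : coset_perm w base_coset = base_coset <-> U w.
Proof.
have -> : U w <-> translate w^-1%g U = U.
  rewrite -(translate_fix w Ugrp); split=> E.
    by rewrite -[X in translate _ X]E translateK.
  by rewrite -[X in translate _ X]E -{1}[w]invgK translateK.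
split=> [/(congr1 val)|E]; first by rewrite val_coset_perm.
by apply: val_inj; rewrite val_coset_perm.
Qed.

Lemma coset_perm_trans C : exists w, coset_perm w base_coset = C.
Proof.
have /LP[i /c_coset[v _ E]] := ssvalP C.
by exists v^-1%g; apply: val_inj; rewrite val_coset_perm invgK.
Qed.

Lemma mem_loop i C :
  (C \in porbit (coset_perm (g i)) base_coset) = (val C \in c i).
Proof.
rewrite -porbitV -(mul_morphV coset_permM).
have step m : val ((coset_perm (g i)^-1 ^+ m)%g base_coset) = iter m (translate (g i)) U.
  elim: m => [|m IH]; first by rewrite expg0 perm1.
  by rewrite expgSr permM val_coset_perm invgK IH.
apply/porbitP/idP => [[m ->]|].
  by rewrite step; elim: m => [|m IH] /=; [apply: Uc | apply: c_step].
have [_ fc _ _] := c_cycle i.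
by move/(fcycle_iter fc (Uc i)) => [m E]; exists m; apply: val_inj; rewrite step.
Qed.

Lemma coset_bouquet : bouquet (fun i => coset_perm (g i)) base_coset.
Proof.
split=> [i C|i k ik C].
  rewrite mem_loop => Ci; apply: val_inj; rewrite val_coset_perm.
  have [_ _ _ fix_off] := c_cycle i.
  rewrite -{1}(fix_off (val C)) ?translateK //.
  by have /LP[k /c_coset] := ssvalP C.
rewrite !mem_loop => Ci Ck; apply: val_inj; exact: c_disj ik _ Ci Ck.
Qed.

Lemma loop_length i : #|porbit (coset_perm (g i)) base_coset| = s i.
Proof.
rewrite -c_size cardE -(size_map val); apply/perm_size/uniq_perm.
- by rewrite map_inj_uniq ?enum_uniq //; exact: val_inj.
- by have [] := c_cycle i.
move=> C; apply/mapP/idP => [[D]|Ci]; first by rewrite mem_enum mem_loop => Di ->.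
have CL : C \in L by apply/LP; exists i.
by exists (SeqSub CL); rewrite ?mem_enum ?mem_loop.
Qed.

End LoopAction.

(** What the rest of the proof uses of the action on cosets: U is the
    stabilizer of o in a transitive action in which the basis acts by a bouquet
    of loops of lengths s. *)
Record loop_action (r : nat) (F : groupType) (g : 'I_r -> F)
    (s : 'I_r -> nat) (U : set F) (T : finType) (rho : F -> {perm T}) (o : T)
    : Prop := LoopAction {
  loop_actM : {morph rho : x y / (x * y)%g};
  loop_act_stab : forall w, rho w o = o <-> U w;
  loop_act_trans : forall x, exists w, rho w o = x;
  loop_act_bouquet : bouquet (fun i => rho (g i)) o;
  loop_act_length : forall i, #|porbit (rho (g i)) o| = s i }.

Lemma loop_subgroup_action (r : nat) (F : groupType) (g : 'I_r -> F) s (U : set F) :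
  (0 < r)%N -> free_basis g -> loop_subgroup g s U ->
  exists (T : finType) (rho : F -> {perm T}) (o : T), loop_action g s U rho o.
Proof.
move=> r0 gB [Ugrp _ [c [c_size c_cycle Uc c_disj]]].
exists (coset_type c), (coset_perm gB c_cycle), (base_coset Uc (Ordinal r0)); split.
- exact: coset_permM.
- exact: coset_perm_base.
- exact: coset_perm_trans.
- exact: coset_bouquet.
- exact: loop_length.
Qed.

(** * Automorphisms stabilizing a loop subgroup *)

Lemma int_scale_closed (V : lmodType int) (Q : V -> Prop) (e : V) (n : int) :
  Q 0 -> (forall a b, Q a -> Q b -> Q (a + b)) -> (forall a, Q a -> Q (- a)) ->
  Q e -> Q (n *: e).
Proof.
move=> Q0 QD QN Qe; have Qn m : Q (m%:Z *: e).
  elim: m => [|m IH]; first by rewrite scale0r.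
  by rewrite intS scalerDl scale1r; apply: QD.
by case: n => m; [exact: Qn | rewrite NegzE scaleNr; apply/QN/Qn].
Qed.

Section Realization.
Variables (r : nat) (F : groupType) (g : 'I_r -> F) (s : 'I_r -> nat).
Variables (U : set F) (T : finType) (rho : F -> {perm T}) (o : T).
Hypotheses (gB : free_basis g) (gact : loop_action g s U rho o).

Let rhoM := loop_actM gact.
Let rho1 := mul_morph1 rhoM.
Let rhoV := mul_morphV rhoM.
Let v := parity_row s.

Lemma aut_stab_mem (gamma : {multiplicative F -> F}) w :
  aut_stab U gamma -> U (gamma w) <-> U w.
Proof.
move=> [/bij_inj gI gU]; split=> [|Uw]; last by rewrite -gU; exists w.
by rewrite -{1}gU => -[x Ux /gI <-].
Qed.

Lemma act_eq x y : rho x o = rho y o <-> U (x * y^-1)%g.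
Proof.
rewrite -(loop_act_stab gact) rhoM rhoV permM; split=> [->|E]; first by rewrite permK.
by rewrite -{2}E permKV.
Qed.

(** As gamma preserves the stabilizer U of o, mapping the point rho w o to
    rho (gamma w) o is a well defined permutation of the points; it conjugates
    rho to rho composed with gamma. *)
Lemma odd_perm_aut_stab (gamma : {multiplicative F -> F}) w :
  aut_stab U gamma -> odd_perm (rho (gamma w)) = odd_perm (rho w).
Proof.
move=> Ug; pose wit x := sval (cid (loop_act_trans gact x)).
have witE x : rho (wit x) o = x := svalP (cid (loop_act_trans gact x)).
have gammaV := mul_morphV (gmulfM (s := gamma)).
have gamma_eq x y : rho (gamma x) o = rho (gamma y) o <-> rho x o = rho y o.
  by rewrite !act_eq -gammaV -gmulfM; apply: aut_stab_mem.
pose k x := rho (gamma (wit x)) o.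
have kE u : k (rho u o) = rho (gamma u) o by apply/gamma_eq/witE.
have k_inj : injective k.
  by move=> x y /gamma_eq; rewrite !witE.
rewrite -[in RHS](odd_permJ _ (perm k_inj)); congr odd_perm.
apply/permP => x; rewrite -[x](permKV (perm k_inj)) permJ.
move: (_ x) => y; rewrite !permE -[y]witE kE -!permM -!rhoM kE.
by rewrite gmulfM.
Qed.

Lemma parity_exponent w :
  (odd_perm (rho w))%:R = \sum_k v 0 k * (exponent g k w)%:~R :> 'F_2.
Proof.
elim/(free_basis_ind gB): w => [|x y IHx IHy|x IH|i].
- by rewrite rho1 odd_perm1 big1 // => k _; rewrite exponent1 // mulr0.
- rewrite rhoM odd_permM; transitivity ((odd_perm (rho x))%:R + (odd_perm (rho y))%:R : 'F_2).
    by case: (odd_perm (rho x)); case: (odd_perm (rho y)); rewrite /= ?addr0 ?add0r ?addF2.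
  rewrite IHx IHy -big_split; apply: eq_bigr => k _.
  by rewrite exponentM // rmorphD mulrDr.
- rewrite rhoV odd_permV IH; apply: eq_bigr => k _.
  by rewrite exponentV // rmorphN /= -[in RHS](addr0 (- _)) -(addF2 (exponent g k x)%:~R) addKr.
- rewrite (bigD1 i) //= big1 => [|k ki]; last first.
    by rewrite exponent_basis // eq_sym (negPf ki) mulr0.
  rewrite exponent_basis // eqxx mulr1 addr0 (odd_loop (loop_act_bouquet gact)).
  by rewrite (loop_act_length gact) mxE; case: odd.
Qed.

Lemma realized_row_stab M : realized g U M -> v *m reduce2 M = v.
Proof.
move=> [gamma Ug <-]; apply/rowP => j.
transitivity ((odd_perm (rho (gamma (g j))))%:R : 'F_2).
  by rewrite parity_exponent mxE; apply: eq_bigr => k _; rewrite !mxE.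
rewrite odd_perm_aut_stab // (odd_loop (loop_act_bouquet gact)).
by rewrite (loop_act_length gact) mxE; case: odd.
Qed.

Lemma conj_aut_stab (gamma : {multiplicative F -> F}) (t : {perm T}) :
  bijective gamma -> t o = o ->
  (forall i, rho (gamma (g i)) = (rho (g i) ^ t)%g) -> aut_stab U gamma.
Proof.
move=> bij_gamma to gJ.
have gammaJ w : rho (gamma w) = (rho w ^ t)%g.
  elim/(free_basis_ind gB): w => [|x y IHx IHy|x IH|//].
  - by rewrite (mul_morph1 (gmulfM (s := gamma))) rho1 conj1g.
  - by rewrite gmulfM !rhoM conjMg IHx IHy.
  - by rewrite (mul_morphV (gmulfM (s := gamma))) !rhoV conjVg IH.
have Ugamma w : U (gamma w) <-> U w.
  rewrite -!(loop_act_stab gact) gammaJ -{1}to permJ; split=> [|->//].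
  by rewrite -{2}to => /perm_inj.
split=> //; apply/seteqP; split=> [_ [x Ux <-]|x Ux]; first exact/Ugamma.
have [f _ fK] := bij_gamma; exists (f x) => //.
by apply/Ugamma; rewrite fK.
Qed.

Lemma sign_flip_realized i : realized g U (sign_flip_mx i).
Proof.
have [gamma gammaE] := basis_hom gB (fun k => if k == i then (g k)^-1%g else g k).
have gammaK : involutive gamma.
  apply: (hom_ext gB (phi := gamma \o gamma) (psi := idfun)) => k /=.
  rewrite gammaE; case: eqP => [->|/eqP ki]; last by rewrite gammaE (negPf ki).
  by rewrite (mul_morphV (gmulfM (s := gamma))) gammaE eqxx invgK.
exists gamma.
  apply: (conj_aut_stab (t := loop_flip (fun i => rho (g i)) o i)).
  - by exists gamma.
  - exact: loop_flip_base.
  - move=> k; rewrite gammaE; case: eqP => [->|/eqP ki].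
      by rewrite (loop_flipJ (loop_act_bouquet gact)) rhoV.
    by rewrite (loop_flipJD (loop_act_bouquet gact)).
apply/matrixP => k l; rewrite -[sign_flip_mx i]mul1mx sign_flip_mxE !mxE gammaE.
by case: eqP => [->|_]; rewrite ?exponentV // exponent_basis // eq_sym.
Qed.

(** A stand-in for membership in the subgroup generated by the g_k, k != j,
    in the form in which the automorphisms multiplying g_j use it. *)
Definition fixed_off j (w : F) : Prop :=
  forall phi : {multiplicative F -> F},
    (forall k, k != j -> phi (g k) = g k) -> phi w = w.

(** Realized by g_j |-> g_j w, which leaves rho unchanged and has the inverse
    g_j |-> g_j w^-1 since both maps fix w. *)
Lemma transvection_realized j w :
  fixed_off j w -> rho w = 1%g ->
  realized g U (transvection (\col_k exponent g k w) (delta_mx 0 j)).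
Proof.
move=> wj rho_w.
pose f (u : F) := fun k => if k == j then (g k * u)%g else g k.
have [gamma gammaE] := basis_hom gB (f w).
have [delta deltaE] := basis_hom gB (f w^-1%g).
have fix_basis u (phi : {multiplicative F -> F}) :
  (forall k, phi (g k) = f u k) -> phi w = w.
  by move=> phiE; apply: wj => k kj; rewrite phiE /f (negPf kj).
have gw := fix_basis _ _ gammaE; have dw := fix_basis _ _ deltaE.
have gammaK : cancel gamma delta.
  apply: (hom_ext gB (phi := delta \o gamma) (psi := idfun)) => k /=.
  rewrite gammaE /f; case: eqP => [->|/eqP kj]; last by rewrite deltaE /f (negPf kj).
  by rewrite gmulfM dw deltaE /f eqxx mulgVK.
have deltaK : cancel delta gamma.
  apply: (hom_ext gB (phi := gamma \o delta) (psi := idfun)) => k /=.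
  rewrite deltaE /f; case: eqP => [->|/eqP kj]; last by rewrite gammaE /f (negPf kj).
  by rewrite gmulfM (mul_morphV (gmulfM (s := gamma))) gw gammaE /f eqxx mulgK.
exists gamma.
  apply: (conj_aut_stab (t := 1%g)); [by exists delta | by rewrite perm1 |].
  by move=> k; rewrite conjg1 gammaE /f; case: eqP => // _; rewrite rhoM rho_w mulg1.
apply/matrixP => k l; rewrite -[transvection _ _]mul1mx mul_transvectionE mul1mx.
rewrite !mxE gammaE /f eqxx /=; case: eqP => _.
  by rewrite exponentM // exponent_basis // mulr1 eq_sym.
by rewrite exponent_basis // mulr0 addr0 eq_sym.
Qed.

Definition loops_off j : {set T} :=
  [set x | [exists k in [pred k | k != j], x \in porbit (rho (g k)) o]]%SET.

(** The pairs of the exponent vector and the permutation of one and the same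
    word: word_off j 0 is the group of permutations by which words can be
    corrected without changing their exponents. *)
Definition word_off j (a : 'cV[int]_r) (t : {perm T}) : Prop :=
  exists w, [/\ fixed_off j w, \col_k exponent g k w = a, rho w = t
              & perm_on (loops_off j) t].

Section WordOff.
Variable j : 'I_r.

Lemma word_off1 : word_off j 0 1%g.
Proof.
exists 1%g; split=> [phi _|||]; last exact: perm_on1.
- exact: mul_morph1 (gmulfM (s := phi)).
- by apply/colP => k; rewrite !mxE exponent1.
- exact: rho1.
Qed.

Lemma word_offM a b t u :
  word_off j a t -> word_off j b u -> word_off j (a + b) (t * u)%g.
Proof.
move=> [x [xj <- <- xX]] [y [yj <- <- yX]]; exists (x * y)%g; split.
- by move=> phi phij; rewrite gmulfM xj // yj.
- by apply/colP => k; rewrite !mxE exponentM.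
- exact: rhoM.
- exact: perm_onM.
Qed.

Lemma word_offV a t : word_off j a t -> word_off j (- a) t^-1%g.
Proof.
move=> [x [xj <- <- xX]]; exists x^-1%g; split.
- by move=> phi phij; rewrite (mul_morphV (gmulfM (s := phi))) xj.
- by apply/colP => k; rewrite !mxE exponentV.
- exact: rhoV.
- exact: perm_onV.
Qed.

Lemma word_off_basis k : k != j -> word_off j (delta_mx k 0) (rho (g k)).
Proof.
move=> kj; exists (g k); split=> //; first by move=> phi; apply.
- by apply/colP => l; rewrite !mxE exponent_basis // eqxx andbT eq_sym.
apply/fintype.subsetP => x; rewrite inE => xk; rewrite inE.
apply/existsP; exists k; rewrite inE kj /=.
exact: (bouquet_moved (loop_act_bouquet gact) xk).
Qed.

Lemma word_off_exists (a : 'cV[int]_r) : a j 0 = 0 -> exists t, word_off j a t.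
Proof.
move=> aj; pose Q (a : 'cV[int]_r) := exists t, word_off j a t.
have Q0 : Q 0 by exists 1%g; exact: word_off1.
have QD a1 a2 : Q a1 -> Q a2 -> Q (a1 + a2).
  by move=> [t1 H1] [t2 H2]; exists (t1 * t2)%g; apply: word_offM.
have QN a1 : Q a1 -> Q (- a1) by move=> [t Ht]; exists t^-1%g; apply: word_offV.
have -> : a = \sum_k a k 0 *: delta_mx k 0.
  by rewrite [LHS]matrix_sum_delta; apply: eq_bigr => k _; rewrite big_ord1.
apply: (big_ind Q) => // k _; have [->|kj] := eqVneq k j.
  by rewrite aj scale0r.
by apply: int_scale_closed => //; exists (rho (g k)); apply: word_off_basis.
Qed.

Lemma transvection_looplet l n : l != j -> s l = 1%N ->
  realized g U (transvection (n *: delta_mx l 0) (delta_mx 0 j)).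
Proof.
move=> lj sl; suff [w [wj <- rw _]] : word_off j (n *: delta_mx l 0) 1%g.
  exact: transvection_realized.
apply: (int_scale_closed (Q := fun a => word_off j a 1%g)).
- exact: word_off1.
- by move=> a b Ha Hb; rewrite -[1%g]mulg1; apply: word_offM.
- by move=> a Ha; rewrite -[1%g]invg1; apply: word_offV.
rewrite -(looplet_trivial (loop_act_bouquet gact) (i := l)) ?(loop_act_length gact) //.
exact: word_off_basis.
Qed.

Lemma nontrivial_loop k : s k != 1%N -> rho (g k) o != o.
Proof.
by apply: contra_neq => /porbit_fixed E; rewrite -(loop_act_length gact) E cards1.
Qed.

(** Some word has the exponents a; its image t is even as v a = 0 modulo 2, so
    [bouquet_even] provides a word with zero exponents and the same image, and
    their quotient is as [transvection_realized] requires. *)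
Lemma transvection_two_loops p q (a : 'cV[int]_r) :
  p != j -> q != j -> p != q -> s p != 1%N -> s q != 1%N ->
  a j 0 = 0 -> v *m map_mx (intmul 1) a = 0 ->
  realized g U (transvection a (delta_mx 0 j)).
Proof.
move=> pj qj pq sp sq aj va.
have [t at_] := word_off_exists aj.
have t_even : ~~ odd_perm t.
  have [w [_ aE <- _]] := at_; apply/negP => odd_w.
  have := parity_exponent w; rewrite odd_w.
  have -> : \sum_k v 0 k * (exponent g k w)%:~R = (v *m map_mx (intmul 1) a) 0 0.
    by rewrite -aE mxE; apply: eq_bigr => k _; rewrite !mxE.
  by rewrite va mxE => /eqP.
have tX : perm_on (loops_off j) t by have [w []] := at_.
have Dt : word_off j 0 t.
  have key := bouquet_even (loop_act_bouquet gact) (J := [pred k | k != j])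
    (D := word_off j 0).
  apply: (key _ _ _ _ _ p q) => //.
  - exact: word_off1.
  - by move=> u1 u2 H1 H2; rewrite -[0]addr0; apply: word_offM.
  - by move=> u Hu; rewrite -oppr0; apply: word_offV.
  - move=> k u kj Hu; rewrite conjgE.
    have := word_offM (word_offV (word_off_basis kj)) (word_offM Hu (word_off_basis kj)).
    by rewrite add0r addNr.
  - move=> i k ij kj.
    have Hi := word_off_basis ij; have Hk := word_off_basis kj.
    have := word_offM (word_offV Hi) (word_offM (word_offV Hk) (word_offM Hi Hk)).
    by rewrite addrA -opprD addNr.
  - exact: nontrivial_loop.
  - exact: nontrivial_loop.
have [w [wj <- rw _]] : word_off j a 1%g.
  by rewrite -(mulgV t) -[a]addr0 -[0]oppr0; apply/word_offM/word_offV.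
exact: transvection_realized.
Qed.

End WordOff.

Hypotheses (r3 : (3 <= r)%N) (few : (#|[set i : 'I_r | s i == 1%N]%SET| <= r - 2)%N).

(** Unless two nontrivial loops remain after removing j, the loop j is one of
    exactly two nontrivial ones and there is a looplet l.  Removing l leaves
    both, so 1 + b e_l is available with b the part of a off l; it conjugates
    1 + e_l e_j to 1 + (e_l + b) e_j, and only a multiple of e_l is missing. *)
Lemma transvection_stab j (a : 'cV[int]_r) : a j 0 = 0 -> v *m map_mx (intmul 1) a = 0 ->
  realized g U (transvection a (delta_mx 0 j)).
Proof.
move=> aj va; pose N := [set i : 'I_r | s i != 1%N]%SET.
have cardN : (2 <= #|N|)%N.
  have := cardsC [set i : 'I_r | s i == 1%N]%SET; rewrite card_ord.
  have -> : (~: [set i : 'I_r | s i == 1%N])%SET = N by apply/setP => i; rewrite !inE.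
  move: few r3; lia.
have two k (b : 'cV[int]_r) : (2 <= #|N :\ k|)%N -> b k 0 = 0 ->
    v *m map_mx (intmul 1) b = 0 -> realized g U (transvection b (delta_mx 0 k)).
  move=> /card_gt1P[p [q [+ + pq]]]; rewrite !inE => /andP[pk sp] /andP[qk sq].
  exact: transvection_two_loops pk qk pq sp sq.
have [N2|N1] := leqP 2 #|N :\ j|%SET; first exact: two.
have [l lN] : exists l, l \notin N.
  apply/existsP; rewrite -negb_forall; apply: contraTN N1 => /forallP A.
  have -> : N = [set: 'I_r]%SET by apply/setP => i; rewrite !inE; have := A i; rewrite inE.
  rewrite -leqNgt; have := cardsD1 j [set: 'I_r]%SET; rewrite cardsT card_ord inE.
  move: r3; lia.
have jN : j \in N.
  by apply: contraLR cardN => jN; rewrite -ltnNge; move: N1; rewrite (cardsD1 j N) (negPf jN).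
have lj : l != j by apply: contraNneq lN => ->.
have sl : s l = 1%N by apply/eqP; move: lN; rewrite inE negbK.
have Nl : (2 <= #|N :\ l|)%N by move: cardN; rewrite (cardsD1 l N) (negPf lN).
pose b := a - a l 0 *: delta_mx l 0.
have bl : b l 0 = 0 by rewrite !mxE !eqxx mulr1 subrr.
have bj : b j 0 = 0 by rewrite !mxE aj eq_sym (negPf lj) mulr0 subrr.
have vb : v *m map_mx (intmul 1) b = 0.
  apply: mx11_eq0; rewrite map_mxB mulmxBr va map_mxZ -scalemxAr map_delta_mx.
  by rewrite mul_delta_col0 ?scaler0 ?subr0 ?mxE // sl.
pose X : 'M[int]_r := transvection b (delta_mx 0 l).
pose Y : 'M[int]_r := transvection (- b) (delta_mx 0 l).
have XY : X *m Y = 1%:M by rewrite transvectionN ?mul_delta_row0.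
have RX : realized g U X by exact: two.
have RY : realized g U Y.
  by apply: two; rewrite // ?map_mxN ?mulmxN ?vb ?oppr0 // mxE bl oppr0.
have Xl : X *m (delta_mx l 0 : 'cV_r) = delta_mx l 0 + b.
  by rewrite mul_transvection_col mul_delta_row mxE !eqxx scale1r.
have jY : (delta_mx 0 j : 'rV_r) *m Y = delta_mx 0 j.
  by rewrite mul_row_transvection mul_delta_row mxE bj oppr0 scale0r addr0.
have := realizedM gB (realizedM gB (realizedM gB RX (transvection_looplet 1 lj sl)) RY)
  (transvection_looplet (a l 0 - 1) lj sl).
rewrite (transvectionJ _ _ XY) scale1r Xl jY transvection_mull; last first.
  by rewrite -scalemxAr mul_delta_col0 ?scaler0 // mxE eqxx (negPf lj).
have -> // : delta_mx l 0 + b + (a l 0 - 1) *: delta_mx l 0 = a.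
by rewrite scalerBl scale1r [X in X + _]addrC addrA addrAC addrK /b subrK.
Qed.

Lemma realized_iff M : realized g U M <-> M \in unitmx /\ v *m reduce2 M = v.
Proof.
split=> [RM|[uM vM]]; first by split; [exact: realized_unit RM | exact: realized_row_stab].
apply: (row_stab_preimage r3 _ _ _ _ _ uM vM) => //.
- exact: realized1.
- exact: realized_unit.
- exact: realizedM.
- by move=> a j; apply: transvection_stab.
- exact: sign_flip_realized.
Qed.

Lemma realized_lift N : N \in unitmx -> v *m N = v ->
  exists2 M, realized g U M & reduce2 M = N.
Proof.
apply: (row_stab_lift r3) => //.
- exact: realized1.
- exact: realizedM.
- by move=> a j; apply: transvection_stab.
Qed.

End Realization.

Theorem theorem1 (r : nat) (F : groupType) (g : 'I_r -> F)
    (s : 'I_r -> nat) (U : set F) :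
  (3 <= r)%N ->
  free_basis g ->
  loop_subgroup g s U ->
  (#|[set i : 'I_r | s i == 1%N]%SET| <= r - 2)%N ->
  let BStab := abel_mx g @` aut_stab U in
  let v := parity_row s in
  [/\ congruence_subgroup2 BStab,
      @reduce2 r @` BStab = row_stab v
    & BStab = [set M | M \in unitmx /\ v *m reduce2 M = v]].
Proof.
move=> r3 gB loopU few BStab v.
have [T [rho [o gact]]] := loop_subgroup_action (ltnW (ltnW r3)) gB loopU.
have BStabP M : BStab M <-> M \in unitmx /\ v *m reduce2 M = v.
  exact: realized_iff gB gact r3 few M.
split.
- split; last first.
    by move=> M [uM M1]; apply/BStabP; rewrite M1 mulmx1.
  split.
  + by move=> M /BStabP[].
  + exact: realized1.
  + exact: realizedM.
  + move=> M /BStabP[uM vM]; apply/BStabP; rewrite unitmx_inv uM; split=> //.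
    by rewrite -{1}vM -mulmxA -reduce2M mulmxV // reduce2_1 mulmx1.
- apply/seteqP; split=> [_ [M /BStabP[uM vM] <-]|N [uN vN]].
    by split=> //; exact: reduce2_unit.
  exact: realized_lift gB gact r3 few N uN vN.
- by apply/seteqP; split=> M /BStabP.
Qed.
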